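(* Let $P$ be a field, let $\Theta=\mathrm{Lie}\text{-}P$ be the variety of all Lie algebras over $P$, and let $H_1,H_2\in\Theta$ satisfy $\mathrm{Var}(H_1)=\mathrm{Var}(H_2)=\Theta$. Then the following three conditions are equivalent: 1. The categories of algebraic sets $K_\Theta(H_1)$ and $K_\Theta(H_2)$ are correctly isomorphic. 2. The categories of algebraic sets $K_\Theta(H_1)$ and $K_\Theta(H_2)$ are correctly equivalent. 3. The algebras $H_1$ and $H_2$ are twisted geometrically equivalent.
   Context: Let $\Theta$ be a variety of algebras; $\mathrm{Var}(H)$ denotes the variety generated by $H$. Fix an infinite set $X^0$. $\Theta^0$ is the category whose objects are the free algebras $W=W(X)$ of $\Theta$ with $X$ a finite subset of $X^0$, and whose morphisms are all homomorphisms. Fix $H\in\Theta$. Galois correspondence. For a set $T\subset W\times W$ put $T'_H=\{\mu\in \mathrm{Hom}(W,H): T\subset \mathrm{Ker}\,\mu\}$, where $\mathrm{Ker}\,\mu=\{(w,w'):w^\mu=w'^\mu\}$; for $A\subset \mathrm{Hom}(W,H)$ put $A'=A'_W=\bigcap_{\mu\in A}\mathrm{Ker}\,\mu$ (equal to $W\times W$ if $A=\emptyset$). Put $T''_H=(T'_H)'$. A set $A$ of the form $T'_H$ is called an algebraic set; a congruence of the form $A'$ is called $H$-closed. Categories. $K^0_\Theta(H)$: objects are the sets $\mathrm{Hom}(W(X),H)$, $W(X)\in \mathrm{Ob}\,\Theta^0$; morphisms $\tilde s:\mathrm{Hom}(W(X),H)\to \mathrm{Hom}(W(Y),H)$ are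 given by homomorphisms $s:W(Y)\to W(X)$ via $\tilde s(\nu)=\nu s$. $K_\Theta(H)$ (algebraic sets over $H$): objects are pairs $(X,A)$ with $A$ an algebraic set in $\mathrm{Hom}(W(X),H)$; morphisms $[s]:(X,A)\to(Y,B)$ are the maps $A\to B$, $\nu\mapsto \nu s$, given by those homomorphisms $s:W(Y)\to W(X)$ with $\nu s\in B$ for all $\nu\in A$. $K^0_\Theta(H)$ is a subcategory of $K_\Theta(H)$. $C_\Theta(H)$: objects are $W/T$ with $W\in \mathrm{Ob}\,\Theta^0$ and $T$ an $H$-closed congruence of $W$; morphisms are homomorphisms. When $\mathrm{Var}(H)=\Theta$, $(X,A)\mapsto W(X)/A'$ and $W(X)/T\mapsto (X,T'_H)$ determine a duality between $K_\Theta(H)$ and $C_\Theta(H)$, and $\Theta^0$ is a subcategory of $C_\Theta(H)$. Hence every functor $F:K_\Theta(H_1)\to K_\Theta(H_2)$ has a corresponding functor $\Phi:C_\Theta(H_1)\to C_\Theta(H_2)$. Correct isomorphism. An isomorphism $F:K_\Theta(H_1)\to K_\Theta(H_2)$, with corresponding isomorphism $\Phi:C_\Theta(H_1)\to C_\Theta(H_2)$, is correct if (1) $\Phi$ induces an automorphism $\varphi:\Theta^0\to\Theta^0$ and $F$ induces an isomorphism $K^0_\Theta(H_1)\to K^0_\Theta(H_2)$; (2) if $(X,A_1),(X,A_2)$ are objects of $K_\Theta(H_1)$ with $A_1\subset A_2$ and $F(X,A_1)=(Y_1,B_1)$, $F(X,A_2)=(Y_2,B_2)$, then $Y_1=Y_2$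 and $B_1\subset B_2$. Correct equivalence (defined in the same spirit). An equivalence given by functors $F_1:K_\Theta(H_1)\to K_\Theta(H_2)$, $F_2:K_\Theta(H_2)\to K_\Theta(H_1)$, with corresponding functors $\Phi_1,\Phi_2$ between $C_\Theta(H_1)$ and $C_\Theta(H_2)$, is correct if (1) $\Phi_1,\Phi_2$ induce functors $\varphi,\psi:\Theta^0\to\Theta^0$ forming an autoequivalence of $\Theta^0$ (that is, $\psi\varphi$ and $\varphi\psi$ are isomorphic to the identity functor), and $F_1,F_2$ induce an equivalence between $K^0_\Theta(H_1)$ and $K^0_\Theta(H_2)$; (2) both $F_1$ and $F_2$ satisfy condition (2) in the definition of a correct isomorphism. Two categories are correctly isomorphic (correctly equivalent) if a correct isomorphism (correct equivalence) between them exists. Geometrical equivalence. $H_1,H_2\in\Theta$ are geometrically equivalent if $T''_{H_1}=T''_{H_2}$ for every $W\in \mathrm{Ob}\,\Theta^0$ and every $T\subset W\times W$. For $\sigma\in \mathrm{Aut}(P)$ and a $P$-algebra $H$, the algebra $H^\sigma$ is $H$ with the same operations except that multiplication by scalars is replaced by $\lambda\circ a=\lambda^{\sigma^{-1}}\cdot a$, $\lambda\in P$, $a\in H$. $H_1$ and $H_2$ are twisted geometrically equivalent if $H_1^\sigma$ and $H_2$ are geometrically equivalent for some $\sigma\in \mathrm{Aut}(P)$. *)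

(* Defs.v *)
From HB Require Import structures.
From mathcomp Require Import all_boot all_algebra generic_quotient.
From mathcomp Require Import finmap.
From mathcomp Require Import boolp classical_sets functions cardinality.

Set Implicit Arguments.
Unset Strict Implicit.
Unset Printing Implicit Defensive.

Import GRing.Theory.
Local Open Scope ring_scope.
Local Open Scope quotient_scope.
Local Open Scope classical_set_scope.

HB.mixin Record Lmodule_isLieAlgebra (P : fieldType) L of GRing.Lmodule P L := {
  bracket : L -> L -> L;
  bracket_linl : forall (a : P) (x y z : L),
    bracket (a *: x + y) z = a *: bracket x z + bracket y z;
  bracket_linr : forall (a : P) (x y z : L),
    bracket x (a *: y + z) = a *: bracket x y + bracket x z;
  bracketxx : forall x : L, bracket x x = 0;
  jacobi : forall x y z : L,
    bracket x (bracket y z) + (bracket y (bracket z x) + bracket z (bracket x y))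
    = 0
}.

#[short(type="lieAlgType")]
HB.structure Definition LieAlgebra (P : fieldType) :=
  { L of Lmodule_isLieAlgebra P L & GRing.Lmodule P L }.

Record lieHom (P : fieldType) (A B : lieAlgType P) := LieHom {
  lie_fun :> A -> B;
  lie_linear : forall (a : P) (x y : A),
    lie_fun (a *: x + y) = a *: lie_fun x + lie_fun y;
  lie_bracket : forall x y : A,
    lie_fun (bracket x y) = bracket (lie_fun x) (lie_fun y) }.

Section LieHom.
Variable P : fieldType.
Implicit Types A B C D : lieAlgType P.

Lemma lieHomP A B (f g : lieHom A B) : f =1 g -> f = g.
Proof.
case: f g => [f f1 f2] [g g1 g2] /= /funext fg.
by subst g; congr LieHom; exact: Prop_irrelevance.
Qed.

Lemma lieHomD A B (f : lieHom A B) x y : f (x + y) = f x + f y.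
Proof. by have := lie_linear f 1 x y; rewrite !scale1r. Qed.

Lemma lieHom0 A B (f : lieHom A B) : f 0 = 0.
Proof. by apply: (addrI (f 0)); rewrite -lieHomD !addr0. Qed.

Lemma lieHomZ A B (f : lieHom A B) a x : f (a *: x) = a *: f x.
Proof. by have := lie_linear f a x 0; rewrite lieHom0 !addr0. Qed.

Lemma lieHomN A B (f : lieHom A B) x : f (- x) = - f x.
Proof. by rewrite -scaleN1r lieHomZ scaleN1r. Qed.

Definition lie_id A : lieHom A A :=
  @LieHom P A A id (fun _ _ _ => erefl) (fun _ _ => erefl).

Lemma lie_comp_linear A B C (g : lieHom B C) (f : lieHom A B) (a : P) (x y : A) :
  (g \o f) (a *: x + y) = a *: (g \o f) x + (g \o f) y.
Proof. by rewrite /= !lie_linear. Qed.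

Lemma lie_comp_bracket A B C (g : lieHom B C) (f : lieHom A B) (x y : A) :
  (g \o f) (bracket x y) = bracket ((g \o f) x) ((g \o f) y).
Proof. by rewrite /= !lie_bracket. Qed.

Definition lie_comp A B C (g : lieHom B C) (f : lieHom A B) : lieHom A C :=
  LieHom (lie_comp_linear g f) (lie_comp_bracket g f).

Lemma lie_compA A B C D (h : lieHom C D) (g : lieHom B C) (f : lieHom A B) :
  lie_comp h (lie_comp g f) = lie_comp (lie_comp h g) f.
Proof. exact: lieHomP. Qed.

Lemma lie_comp1f A B (f : lieHom A B) : lie_comp (lie_id B) f = f.
Proof. exact: lieHomP. Qed.

Lemma lie_compf1 A B (f : lieHom A B) : lie_comp f (lie_id A) = f.
Proof. exact: lieHomP. Qed.

End LieHom.

(* Algebras in the signature of Lie algebras, subject to no identities: both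
   the absolutely free algebra of terms and the Lie algebras themselves are
   instances, so that free Lie algebras and quotients by a congruence are the
   same construction. *)
Record preLie (P : fieldType) := PreLie {
  pcar :> choiceType;
  pzero : pcar;
  popp : pcar -> pcar;
  padd : pcar -> pcar -> pcar;
  pscale : P -> pcar -> pcar;
  pbracket : pcar -> pcar -> pcar }.

Arguments pzero {P S} : rename.
Arguments popp {P S} : rename.
Arguments padd {P S} : rename.
Arguments pscale {P S} : rename.
Arguments pbracket {P S} : rename.

(* Congruences whose quotient satisfies the identities of Lie algebras. *)
Record lieCongruence (P : fieldType) (S : preLie P) (R : S -> S -> Prop) : Prop :=
  LieCongruence {
  cg_refl : forall x, R x x;
  cg_sym : forall x y, R x y -> R y x;
  cg_trans : forall x y z, R x y -> R y z -> R x z;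
  cg_opp : forall x y, R x y -> R (popp x) (popp y);
  cg_add : forall x x' y y', R x x' -> R y y' -> R (padd x y) (padd x' y');
  cg_scale : forall a x y, R x y -> R (pscale a x) (pscale a y);
  cg_bracket : forall x x' y y',
    R x x' -> R y y' -> R (pbracket x y) (pbracket x' y');
  cg_addA : forall x y z, R (padd x (padd y z)) (padd (padd x y) z);
  cg_addC : forall x y, R (padd x y) (padd y x);
  cg_add0 : forall x, R (padd pzero x) x;
  cg_addN : forall x, R (padd (popp x) x) pzero;
  cg_scaleA : forall a b x, R (pscale a (pscale b x)) (pscale (a * b) x);
  cg_scale1 : forall x, R (pscale 1 x) x;
  cg_scaleDr : forall a x y,
    R (pscale a (padd x y)) (padd (pscale a x) (pscale a y));
  cg_scaleDl : forall x a b,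
    R (pscale (a + b) x) (padd (pscale a x) (pscale b x));
  cg_linl : forall a x y z,
    R (pbracket (padd (pscale a x) y) z)
      (padd (pscale a (pbracket x z)) (pbracket y z));
  cg_linr : forall a x y z,
    R (pbracket x (padd (pscale a y) z))
      (padd (pscale a (pbracket x y)) (pbracket x z));
  cg_xx : forall x, R (pbracket x x) pzero;
  cg_jacobi : forall x y z,
    R (padd (pbracket x (pbracket y z))
        (padd (pbracket y (pbracket z x)) (pbracket z (pbracket x y))))
      pzero }.

Section Quotient.
Variables (P : fieldType) (S : preLie P) (R : S -> S -> Prop).
Hypothesis hR : lieCongruence R.

Lemma lquot_refl : reflexive (fun x y => `[<R x y>]).
Proof. by move=> x; apply/asboolP/(cg_refl hR). Qed.

Lemma lquot_sym : symmetric (fun x y => `[<R x y>]).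
Proof. by move=> x y; apply/asbool_equiv_eq; split; exact: (cg_sym hR). Qed.

Lemma lquot_trans : transitive (fun x y => `[<R x y>]).
Proof.
by move=> y x z /asboolP xy /asboolP yz; apply/asboolP; exact: (cg_trans hR xy yz).
Qed.

Definition lquot_equiv : equiv_rel S :=
  EquivRel (fun x y => `[<R x y>]) lquot_refl lquot_sym lquot_trans.

Definition lquot : Type := {eq_quot lquot_equiv}.
HB.instance Definition _ := Choice.on lquot.

Definition lpi (x : S) : lquot := \pi_({eq_quot lquot_equiv}) x.
Definition lrepr (x : lquot) : S := repr (x : {eq_quot lquot_equiv}).

Lemma lreprK x : lpi (lrepr x) = x.
Proof. exact: reprK. Qed.

Lemma lpiP x y : lpi x = lpi y <-> R x y.
Proof.
split=> [xy|xy]; last by apply/eqmodP/asboolP.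
by have /eqmodP/asboolP := xy.
Qed.

Lemma lpi_repr x : R (lrepr (lpi x)) x.
Proof. by apply/lpiP; rewrite lreprK. Qed.

Let qadd (x y : lquot) := lpi (padd (lrepr x) (lrepr y)).
Let qopp (x : lquot) := lpi (popp (lrepr x)).
Let qscale a (x : lquot) := lpi (pscale a (lrepr x)).
Let qbracket (x y : lquot) := lpi (pbracket (lrepr x) (lrepr y)).

Let qaddE x y : qadd (lpi x) (lpi y) = lpi (padd x y).
Proof. by apply/lpiP/(cg_add hR); exact: lpi_repr. Qed.
Let qoppE x : qopp (lpi x) = lpi (popp x).
Proof. by apply/lpiP/(cg_opp hR); exact: lpi_repr. Qed.
Let qscaleE a x : qscale a (lpi x) = lpi (pscale a x).
Proof. by apply/lpiP/(cg_scale hR); exact: lpi_repr. Qed.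
Let qbracketE x y : qbracket (lpi x) (lpi y) = lpi (pbracket x y).
Proof. by apply/lpiP/(cg_bracket hR); exact: lpi_repr. Qed.

Let qaddA : associative qadd.
Proof.
move=> x y z; rewrite -[x]lreprK -[y]lreprK -[z]lreprK !qaddE.
exact/lpiP/(cg_addA hR).
Qed.
Let qaddC : commutative qadd.
Proof.
by move=> x y; rewrite -[x]lreprK -[y]lreprK !qaddE; apply/lpiP/(cg_addC hR).
Qed.
Let qadd0 : left_id (lpi pzero) qadd.
Proof. by move=> x; rewrite -[x]lreprK qaddE; apply/lpiP/(cg_add0 hR). Qed.
Let qaddN : left_inverse (lpi pzero) qopp qadd.
Proof. by move=> x; rewrite -[x]lreprK qoppE qaddE; apply/lpiP/(cg_addN hR). Qed.

HB.instance Definition _ := GRing.isZmodule.Build lquot qaddA qaddC qadd0 qaddN.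

Let qscaleA a b x : qscale a (qscale b x) = qscale (a * b) x.
Proof. by rewrite -[x]lreprK !qscaleE; apply/lpiP/(cg_scaleA hR). Qed.
Let qscale1 : left_id 1 qscale.
Proof. by move=> x; rewrite -[x]lreprK qscaleE; apply/lpiP/(cg_scale1 hR). Qed.
Let qscaleDr : right_distributive qscale +%R.
Proof.
move=> a x y; rewrite -[x]lreprK -[y]lreprK [_ + _]qaddE !qscaleE.
by rewrite [RHS]qaddE; apply/lpiP/(cg_scaleDr hR).
Qed.
Let qscaleDl x : {morph qscale^~ x : a b / a + b}.
Proof.
move=> a b; rewrite -[x]lreprK !qscaleE [RHS]qaddE.
exact/lpiP/(cg_scaleDl hR).
Qed.

HB.instance Definition _ :=
  GRing.Zmodule_isLmodule.Build P lquot qscaleA qscale1 qscaleDr qscaleDl.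

Lemma lpi0 : lpi pzero = 0. Proof. by []. Qed.
Lemma lpiD x y : lpi (padd x y) = lpi x + lpi y.
Proof. by rewrite -qaddE. Qed.
Lemma lpiN x : lpi (popp x) = - lpi x.
Proof. by rewrite -qoppE. Qed.
Lemma lpiZ a x : lpi (pscale a x) = a *: lpi x.
Proof. by rewrite -qscaleE. Qed.

Let qlinl a (x y z : lquot) :
  qbracket (a *: x + y) z = a *: qbracket x z + qbracket y z.
Proof.
rewrite -[x]lreprK -[y]lreprK -[z]lreprK -lpiZ -lpiD !qbracketE -lpiZ -lpiD.
exact/lpiP/(cg_linl hR).
Qed.
Let qlinr a (x y z : lquot) :
  qbracket x (a *: y + z) = a *: qbracket x y + qbracket x z.
Proof.
rewrite -[x]lreprK -[y]lreprK -[z]lreprK -lpiZ -lpiD !qbracketE -lpiZ -lpiD.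
exact/lpiP/(cg_linr hR).
Qed.
Let qxx (x : lquot) : qbracket x x = 0.
Proof. by rewrite -[x]lreprK qbracketE; apply/lpiP/(cg_xx hR). Qed.
Let qjacobi (x y z : lquot) :
  qbracket x (qbracket y z) + (qbracket y (qbracket z x) + qbracket z (qbracket x y))
  = 0.
Proof.
rewrite -[x]lreprK -[y]lreprK -[z]lreprK !qbracketE -!lpiD.
exact/lpiP/(cg_jacobi hR).
Qed.

HB.instance Definition _ :=
  Lmodule_isLieAlgebra.Build P lquot qlinl qlinr qxx qjacobi.

Lemma lpi_bracket x y : lpi (pbracket x y) = bracket (lpi x) (lpi y).
Proof. by rewrite -qbracketE. Qed.

Section Lift.
Variables (L : lieAlgType P) (g : S -> L).
Hypotheses (gD : forall x y, g (padd x y) = g x + g y)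
  (gZ : forall a x, g (pscale a x) = a *: g x)
  (gB : forall x y, g (pbracket x y) = bracket (g x) (g y))
  (gR : forall x y, R x y -> g x = g y).

Let lift_linear a (x y : lquot) :
  g (lrepr (a *: x + y)) = a *: g (lrepr x) + g (lrepr y).
Proof.
rewrite -gZ -gD; apply/gR/lpiP.
by rewrite lreprK lpiD lpiZ !lreprK.
Qed.

Let lift_bracket (x y : lquot) :
  g (lrepr (bracket x y)) = bracket (g (lrepr x)) (g (lrepr y)).
Proof. by rewrite -gB; apply/gR/lpiP; rewrite lreprK lpi_bracket !lreprK. Qed.

Definition lquot_lift : lieHom lquot L := LieHom lift_linear lift_bracket.

Lemma lquot_liftE x : lquot_lift (lpi x) = g x.
Proof. exact/gR/lpi_repr. Qed.

End Lift.

End Quotient.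

Inductive lieTerm (P : fieldType) (V : Type) : Type :=
| TVar of V
| TZero
| TOpp of lieTerm P V
| TAdd of lieTerm P V & lieTerm P V
| TScale of P & lieTerm P V
| TBracket of lieTerm P V & lieTerm P V.

Arguments TVar {P V}.
Arguments TZero {P V}.

HB.instance Definition _ (P : fieldType) (V : Type) := gen_eqMixin (lieTerm P V).
HB.instance Definition _ (P : fieldType) (V : Type) :=
  gen_choiceMixin (lieTerm P V).

Section Free.
Variable P : fieldType.

Definition term_preLie (V : Type) : preLie P :=
  @PreLie P (lieTerm P V) TZero (@TOpp P V) (@TAdd P V) (@TScale P V)
    (@TBracket P V).

(* The least congruence on terms whose quotient is a Lie algebra. *)
Definition term_eq (V : Type) (t u : term_preLie V) : Prop :=
  forall R : term_preLie V -> term_preLie V -> Prop, lieCongruence R -> R t u.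

Lemma term_eq_cong (V : Type) : lieCongruence (@term_eq V).
Proof.
split.
- by move=> x R hR; apply: (cg_refl hR).
- by move=> x y xy R hR; apply: (cg_sym hR); apply: xy.
- by move=> x y z xy yz R hR; apply: (cg_trans hR (xy R hR) (yz R hR)).
- by move=> x y xy R hR; apply: (cg_opp hR); apply: xy.
- by move=> x x' y y' xx yy R hR; apply: (cg_add hR); [apply: xx|apply: yy].
- by move=> a x y xy R hR; apply: (cg_scale hR); apply: xy.
- by move=> x x' y y' xx yy R hR; apply: (cg_bracket hR); [apply: xx|apply: yy].
- by move=> x y z R hR; apply: (cg_addA hR).
- by move=> x y R hR; apply: (cg_addC hR).
- by move=> x R hR; apply: (cg_add0 hR).
- by move=> x R hR; apply: (cg_addN hR).
- by move=> a b x R hR; apply: (cg_scaleA hR).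
- by move=> x R hR; apply: (cg_scale1 hR).
- by move=> a x y R hR; apply: (cg_scaleDr hR).
- by move=> x a b R hR; apply: (cg_scaleDl hR).
- by move=> a x y z R hR; apply: (cg_linl hR).
- by move=> a x y z R hR; apply: (cg_linr hR).
- by move=> x R hR; apply: (cg_xx hR).
- by move=> x y z R hR; apply: (cg_jacobi hR).
Qed.

Definition freeLie (V : Type) : lieAlgType P := lquot (@term_eq_cong V).

Definition gen (V : Type) (x : V) : freeLie V :=
  lpi (@term_eq_cong V) (TVar x).

Fixpoint teval (V : Type) (L : lieAlgType P) (f : V -> L) (t : lieTerm P V) : L :=
  match t with
  | TVar x => f x
  | TZero => 0
  | TOpp t => - teval f t
  | TAdd t u => teval f t + teval f u
  | TScale a t => a *: teval f t
  | TBracket t u => bracket (teval f t) (teval f u)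
  end.

Lemma teval_cong (V : Type) (L : lieAlgType P) (f : V -> L) :
  @lieCongruence P (term_preLie V) (fun t u => teval f t = teval f u).
Proof.
split => //=.
- by move=> x y z -> .
- by move=> x y -> .
- by move=> x x' y y' -> -> .
- by move=> a x y -> .
- by move=> x x' y y' -> -> .
- by move=> x y z; rewrite addrA.
- by move=> x y; rewrite addrC.
- by move=> x; rewrite add0r.
- by move=> x; rewrite addNr.
- by move=> a b x; rewrite scalerA.
- by move=> x; rewrite scale1r.
- by move=> a x y; rewrite scalerDr.
- by move=> x a b; rewrite scalerDl.
- by move=> a x y z; rewrite bracket_linl.
- by move=> a x y z; rewrite bracket_linr.
- by move=> x; rewrite bracketxx.
- by move=> x y z; rewrite jacobi.
Qed.

Definition free_ext (V : Type) (L : lieAlgType P) (f : V -> L) :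
    lieHom (freeLie V) L :=
  @lquot_lift P (term_preLie V) _ (@term_eq_cong V) L (teval f)
    (fun _ _ => erefl) (fun _ _ => erefl) (fun _ _ => erefl)
    (fun t u tu => tu _ (teval_cong f)).

Lemma free_extE (V : Type) (L : lieAlgType P) (f : V -> L) t :
  free_ext f (lpi (@term_eq_cong V) t) = teval f t.
Proof. exact: lquot_liftE. Qed.

Lemma free_ext_gen (V : Type) (L : lieAlgType P) (f : V -> L) x :
  free_ext f (gen x) = f x.
Proof. exact: free_extE. Qed.

Lemma lieHom_teval (V : Type) (A B : lieAlgType P) (h : lieHom A B) (f : V -> A) t :
  h (teval f t) = teval (h \o f) t.
Proof.
elim: t => //= [|t <-|t <- u <-|a t <-|t <- u <-].
- exact: lieHom0.
- exact: lieHomN.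
- exact: lieHomD.
- exact: lieHomZ.
- exact: lie_bracket.
Qed.

Lemma teval_gen (V : Type) (t : lieTerm P V) :
  teval (@gen V) t = lpi (@term_eq_cong V) t.
Proof.
elim: t => //= [t ->|t -> u ->|a t ->|t -> u ->].
- by rewrite -lpiN.
- by rewrite -lpiD.
- by rewrite -lpiZ.
- by rewrite -lpi_bracket.
Qed.

Lemma free_hom_ext (V : Type) (L : lieAlgType P) (f g : lieHom (freeLie V) L) :
  (forall x, f (gen x) = g (gen x)) -> f = g.
Proof.
move=> fg; apply: lieHomP => w.
rewrite -[w](lreprK (hR := @term_eq_cong V)) -teval_gen !lieHom_teval.
by congr teval; apply/funext => x; exact: fg.
Qed.

End Free.

Section Variety.
Variable P : fieldType.

Definition satisfies (L : lieAlgType P) (e : lieTerm P nat * lieTerm P nat) :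
    Prop :=
  forall f : nat -> L, teval f e.1 = teval f e.2.

Definition models (E : set (lieTerm P nat * lieTerm P nat))
    (L : lieAlgType P) : Prop :=
  forall e, E e -> satisfies L e.

(* Classes of algebras are predicates rather than elements of type set, since
   lieAlgType P lives in too large a universe for the latter. *)
Definition is_variety (V : lieAlgType P -> Prop) : Prop :=
  exists E, forall L, V L <-> models E L.

(* Var(H) = Theta is expressed by: forall L, Var H L. *)
Definition Var (H L : lieAlgType P) : Prop :=
  forall V : lieAlgType P -> Prop, is_variety V -> V H -> V L.

End Variety.

Section Twist.
Variable P : fieldType.

Record fieldAut := FieldAut {
  aut_fun :> {rmorphism P -> P};
  aut_inv : {rmorphism P -> P};
  aut_funK : cancel aut_fun aut_inv;
  aut_invK : cancel aut_inv aut_fun }.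

Definition twist (s : fieldAut) (H : lieAlgType P) : Type := H.

Variables (s : fieldAut) (H : lieAlgType P).
Local Notation Hs := (twist s H).

HB.instance Definition _ := GRing.Zmodule.copy Hs H.

Let tscale (a : P) (x : Hs) : Hs := aut_inv s a *: (x : H).

Let tscaleA a b x : tscale a (tscale b x) = tscale (a * b) x.
Proof. by rewrite /tscale scalerA rmorphM. Qed.
Let tscale1 : left_id 1 tscale.
Proof. by move=> x; rewrite /tscale rmorph1 scale1r. Qed.
Let tscaleDr : right_distributive tscale +%R.
Proof. by move=> a x y; rewrite /tscale scalerDr. Qed.
Let tscaleDl x : {morph tscale^~ x : a b / a + b}.
Proof. by move=> a b; rewrite /tscale rmorphD scalerDl. Qed.

HB.instance Definition _ :=
  GRing.Zmodule_isLmodule.Build P Hs tscaleA tscale1 tscaleDr tscaleDl.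

Let tbracket (x y : Hs) : Hs := bracket (x : H) (y : H).

Let tlinl a (x y z : Hs) :
  tbracket (a *: x + y) z = a *: tbracket x z + tbracket y z.
Proof. exact: bracket_linl. Qed.
Let tlinr a (x y z : Hs) :
  tbracket x (a *: y + z) = a *: tbracket x y + tbracket x z.
Proof. exact: bracket_linr. Qed.
Let txx (x : Hs) : tbracket x x = 0.
Proof. exact: bracketxx. Qed.
Let tjacobi (x y z : Hs) :
  tbracket x (tbracket y z) + (tbracket y (tbracket z x) + tbracket z (tbracket x y))
  = 0.
Proof. exact: jacobi. Qed.

HB.instance Definition _ :=
  Lmodule_isLieAlgebra.Build P Hs tlinl tlinr txx tjacobi.

End Twist.

Section Galois.
Variables (P : fieldType) (W H : lieAlgType P).

Definition Ker (mu : lieHom W H) : set (W * W) := [set p | mu p.1 = mu p.2].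

Definition solutions (T : set (W * W)) : set (lieHom W H) :=
  [set mu | T `<=` Ker mu].

Definition kernel (A : set (lieHom W H)) : set (W * W) :=
  \bigcap_(mu in A) Ker mu.

Definition algebraic (A : set (lieHom W H)) : Prop := exists T, A = solutions T.

Definition closed_cong (T : set (W * W)) : Prop := exists A, T = kernel A.

Lemma solutionsT : algebraic setT.
Proof. by exists set0; apply/seteqP; split => // mu _ p []. Qed.

Lemma solutions_kernel A : algebraic A -> solutions (kernel A) = A.
Proof.
move=> [T ->]; apply/seteqP; split => mu.
  by move=> muT p Tp; apply: muT => nu nuT; exact: nuT.
by move=> muT p; apply.
Qed.

Lemma kernel_solutions T : closed_cong T -> kernel (solutions T) = T.
Proof.
move=> [A ->]; apply/seteqP; split => p.
  by move=> pA mu Amu; apply: pA => q; apply.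
by move=> pA mu; apply.
Qed.

Definition lie_preLie : preLie P :=
  @PreLie P W 0 -%R +%R *:%R (@bracket P W).

Lemma closed_congP (T : set (W * W)) : closed_cong T ->
  @lieCongruence P lie_preLie (fun x y => T (x, y)).
Proof.
move=> [A ->]; split => /=.
- by move=> x mu _.
- by move=> x y xy mu Amu; rewrite /Ker /= xy.
- by move=> x y z xy yz mu Amu; rewrite /Ker /= (xy _ Amu) (yz _ Amu).
- by move=> x y xy mu Amu; rewrite /Ker /= !lieHomN (xy _ Amu).
- move=> x x' y y' xx yy mu Amu.
  by rewrite /Ker /= !lieHomD (xx _ Amu) (yy _ Amu).
- by move=> a x y xy mu Amu; rewrite /Ker /= !lieHomZ (xy _ Amu).
- move=> x x' y y' xx yy mu Amu.
  by rewrite /Ker /= !lie_bracket (xx _ Amu) (yy _ Amu).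
- by move=> x y z mu Amu; rewrite /Ker /= addrA.
- by move=> x y mu Amu; rewrite /Ker /= addrC.
- by move=> x mu Amu; rewrite /Ker /= add0r.
- by move=> x mu Amu; rewrite /Ker /= addNr.
- by move=> a b x mu Amu; rewrite /Ker /= scalerA.
- by move=> x mu Amu; rewrite /Ker /= scale1r.
- by move=> a x y mu Amu; rewrite /Ker /= scalerDr.
- by move=> x a b mu Amu; rewrite /Ker /= scalerDl.
- by move=> a x y z mu Amu; rewrite /Ker /= bracket_linl.
- by move=> a x y z mu Amu; rewrite /Ker /= bracket_linr.
- by move=> x mu Amu; rewrite /Ker /= bracketxx.
- by move=> x y z mu Amu; rewrite /Ker /= jacobi.
Qed.

Variables (T : set (W * W)) (hT : closed_cong T).

Definition quotLie : lieAlgType P := lquot (closed_congP hT).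

Let pi_linear (a : P) (x y : W) :
  lpi (closed_congP hT) (a *: x + y)
  = a *: lpi (closed_congP hT) x + lpi (closed_congP hT) y.
Proof. by rewrite -lpiZ -lpiD. Qed.

Let pi_bracket (x y : W) :
  lpi (closed_congP hT) (bracket x y)
  = bracket (lpi (closed_congP hT) x) (lpi (closed_congP hT) y).
Proof. by rewrite -lpi_bracket. Qed.

Definition quot_pi : lieHom W quotLie :=
  @LieHom P W quotLie (lpi (closed_congP hT)) pi_linear pi_bracket.

Lemma quot_piP x y : quot_pi x = quot_pi y <-> T (x, y).
Proof. exact: lpiP. Qed.

Lemma quot_pi_surj (x : quotLie) : exists w, quot_pi w = x.
Proof. by exists (lrepr (hR := closed_congP hT) x); exact: lreprK. Qed.

Lemma quot_hom_ext (L : lieAlgType P) (f g : lieHom quotLie L) :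
  lie_comp f quot_pi = lie_comp g quot_pi -> f = g.
Proof.
move=> fg; apply: lieHomP => x; have [w <-] := quot_pi_surj x.
exact: (congr1 (fun h : lieHom W L => h w) fg).
Qed.

Definition quot_lift (L : lieAlgType P) (g : lieHom W L)
    (gT : forall x y, T (x, y) -> g x = g y) : lieHom quotLie L :=
  @lquot_lift P lie_preLie _ (closed_congP hT) L g (lieHomD g) (lieHomZ g)
    (lie_bracket g) gT.

Lemma quot_liftK (L : lieAlgType P) (g : lieHom W L)
    (gT : forall x y, T (x, y) -> g x = g y) :
  lie_comp (quot_lift gT) quot_pi = g.
Proof. by apply: lieHomP => x; exact: lquot_liftE. Qed.

End Galois.
Arguments solutions {P W} H T _.
Arguments closed_cong {P W} H T.
Arguments quot_pi {P W H T} hT.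
Arguments quot_lift {P W H T} hT {L g} gT.

Section GeometricEquivalence.
Variables (P : fieldType) (X0 : choiceType).

Definition geom_equiv (H1 H2 : lieAlgType P) : Prop :=
  forall (X : {fset X0}) (T : set (freeLie P X * freeLie P X)),
    kernel (solutions H1 T) = kernel (solutions H2 T).

Definition twisted_geom_equiv (H1 H2 : lieAlgType P) : Prop :=
  exists s : fieldAut P, geom_equiv (twist s H1) H2.

End GeometricEquivalence.

Record category := Category {
  ob :> Type;
  hom : ob -> ob -> Type;
  idm : forall a, hom a a;
  cmp : forall a b c, hom b c -> hom a b -> hom a c;
  cmpA : forall a b c d (h : hom c d) (g : hom b c) (f : hom a b),
    cmp h (cmp g f) = cmp (cmp h g) f;
  cmp1f : forall a b (f : hom a b), cmp (idm b) f = f;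
  cmpf1 : forall a b (f : hom a b), cmp f (idm a) = f }.

Record functor (C D : category) := Functor {
  fob :> C -> D;
  fhom : forall a b : C, hom a b -> hom (fob a) (fob b);
  fhom1 : forall a : C, fhom (idm a) = idm (fob a);
  fhomM : forall (a b c : C) (g : hom b c) (f : hom a b),
    fhom (cmp g f) = cmp (fhom g) (fhom f) }.

Definition op_cat (C : category) : category :=
  @Category C (fun a b => @hom C b a) (@idm C) (fun a b c g f => @cmp C c b a f g)
    (fun a b c d h g f => esym (@cmpA C d c b a f g h))
    (fun a b f => @cmpf1 C b a f) (fun a b f => @cmp1f C b a f).

Definition unop_functor (C D : category) (F : functor (op_cat C) (op_cat D)) :
    functor C D :=
  @Functor C D (fob F) (fun a b f => @fhom _ _ F b a f) (@fhom1 _ _ F)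
    (fun a b c g f => @fhomM _ _ F c b a f g).

Definition id_functor (C : category) : functor C C :=
  @Functor C C id (fun _ _ f => f) (fun _ => erefl) (fun _ _ _ _ _ => erefl).

Section FunctorComp.
Variables (C D E : category) (G : functor D E) (F : functor C D).

Let comp_hom1 (a : C) : fhom G (fhom F (idm a)) = idm (G (F a)).
Proof. by rewrite !fhom1. Qed.

Let comp_homM (a b c : C) (g : hom b c) (f : hom a b) :
  fhom G (fhom F (cmp g f)) = cmp (fhom G (fhom F g)) (fhom G (fhom F f)).
Proof. by rewrite !fhomM. Qed.

Definition comp_functor : functor C E :=
  @Functor C E (fun a => G (F a)) (fun _ _ f => fhom G (fhom F f))
    comp_hom1 comp_homM.

End FunctorComp.

Definition is_iso (C D : category) (F : functor C D) : Prop :=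
  exists G : functor D C,
    comp_functor G F = id_functor C /\ comp_functor F G = id_functor D.

Definition nat_iso (C D : category) (F G : functor C D) : Prop :=
  exists (u : forall a, hom (F a) (G a)) (v : forall a, hom (G a) (F a)),
    [/\ forall a, cmp (v a) (u a) = idm (F a),
        forall a, cmp (u a) (v a) = idm (G a) &
        forall (a b : C) (f : hom a b), cmp (u b) (fhom F f) = cmp (fhom G f) (u a)].

Definition is_equivalence (C D : category) (F : functor C D) (G : functor D C) :
    Prop :=
  nat_iso (comp_functor G F) (id_functor C) /\
  nat_iso (comp_functor F G) (id_functor D).

(* For subcategories embedded by I : C0 -> C and J : D0 -> D, the functor
   F : C -> D maps the first one into the second one, with restriction F0. *)
Definition induces (C0 C D0 D : category) (I : functor C0 C) (J : functor D0 D)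
    (F : functor C D) (F0 : functor C0 D0) : Prop :=
  comp_functor F I = comp_functor J F0.

Lemma sval_inj (T : Type) (Q : T -> Prop) (x y : {z | Q z}) :
  sval x = sval y -> x = y.
Proof.
case: x y => [x hx] [y hy] /= xy; subst y.
by congr exist; exact: Prop_irrelevance.
Qed.

Section Categories.
Variables (P : fieldType) (X0 : choiceType).

Local Notation W X := (freeLie P X).

(* The object W(X) is represented by X. *)
Definition Theta0 : category :=
  @Category {fset X0} (fun X Y => lieHom (W X) (W Y)) (fun X => lie_id (W X))
    (fun _ _ _ g f => lie_comp g f) (fun _ _ _ _ h g f => lie_compA h g f)
    (fun _ _ f => lie_comp1f f) (fun _ _ f => lie_compf1 f).

Variable H : lieAlgType P.

Definition K0hom (X Y : {fset X0}) : Type :=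
  {f : lieHom (W X) H -> lieHom (W Y) H |
    exists s : lieHom (W Y) (W X), forall nu, f nu = lie_comp nu s}.

Lemma K0homP X Y (f g : K0hom X Y) : (forall nu, sval f nu = sval g nu) -> f = g.
Proof. by move=> /funext fg; exact: sval_inj. Qed.

Lemma K0id_subproof (X : {fset X0}) :
  exists s : lieHom (W X) (W X),
    forall nu : lieHom (W X) H, id nu = lie_comp nu s.
Proof. by exists (lie_id (W X)) => nu; rewrite lie_compf1. Qed.

Definition K0id X : K0hom X X := exist _ id (K0id_subproof X).

Lemma K0comp_subproof X Y Z (g : K0hom Y Z) (f : K0hom X Y) :
  exists s : lieHom (W Z) (W X),
    forall nu, (sval g \o sval f) nu = lie_comp nu s.
Proof.
case: g f => [g [t gt]] [f [s fs]]; exists (lie_comp s t) => nu /=.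
by rewrite gt fs lie_compA.
Qed.

Definition K0comp X Y Z (g : K0hom Y Z) (f : K0hom X Y) : K0hom X Z :=
  exist _ (sval g \o sval f) (K0comp_subproof g f).

(* The object Hom(W(X), H) is represented by X. *)
Program Definition K0 : category :=
  @Category {fset X0} K0hom K0id K0comp _ _ _.
Next Obligation. exact: K0homP. Qed.
Next Obligation. exact: K0homP. Qed.
Next Obligation. exact: K0homP. Qed.

Record Kob := KOb {
  kvars : {fset X0};
  kset : set (lieHom (W kvars) H);
  kset_algebraic : algebraic kset }.
Arguments kset : clear implicits.

Definition Khom (O1 O2 : Kob) : Type :=
  {f : {nu | kset O1 nu} -> {nu | kset O2 nu} |
    exists s : lieHom (W (kvars O2)) (W (kvars O1)),
      forall nu, sval (f nu) = lie_comp (sval nu) s}.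

Lemma KhomP O1 O2 (f g : Khom O1 O2) :
  (forall nu, sval (sval f nu) = sval (sval g nu)) -> f = g.
Proof.
by move=> fg; apply: sval_inj; apply/funext => nu; apply: sval_inj; exact: fg.
Qed.

Lemma Kid_subproof (O : Kob) :
  exists s : lieHom (W (kvars O)) (W (kvars O)),
    forall nu : {nu | kset O nu}, sval (id nu) = lie_comp (sval nu) s.
Proof. by exists (lie_id _) => nu; rewrite lie_compf1. Qed.

Definition Kid O : Khom O O := exist _ id (Kid_subproof O).

Lemma Kcomp_subproof O1 O2 O3 (g : Khom O2 O3) (f : Khom O1 O2) :
  exists s : lieHom (W (kvars O3)) (W (kvars O1)),
    forall nu, sval ((sval g \o sval f) nu) = lie_comp (sval nu) s.
Proof.
case: g f => [g [t gt]] [f [s fs]]; exists (lie_comp s t) => nu /=.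
by rewrite gt fs lie_compA.
Qed.

Definition Kcomp O1 O2 O3 (g : Khom O2 O3) (f : Khom O1 O2) : Khom O1 O3 :=
  exist _ (sval g \o sval f) (Kcomp_subproof g f).

Program Definition K : category := @Category Kob Khom Kid Kcomp _ _ _.
Next Obligation. exact: KhomP. Qed.
Next Obligation. exact: KhomP. Qed.
Next Obligation. exact: KhomP. Qed.

Definition K0_in_K_ob (X : {fset X0}) : Kob := KOb (@solutionsT P (W X) H).

Definition K0_in_K_fun X Y (f : K0hom X Y)
    (nu : {nu | kset (K0_in_K_ob X) nu}) : {nu | kset (K0_in_K_ob Y) nu} :=
  exist _ (sval f (sval nu)) I.

Lemma K0_in_K_subproof X Y (f : K0hom X Y) :
  exists s : lieHom (W Y) (W X),
    forall nu, sval (K0_in_K_fun f nu) = lie_comp (sval nu) s.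
Proof. by case: f => f [s fs]; exists s => nu /=. Qed.

Program Definition K0_in_K : functor K0 K :=
  @Functor K0 K K0_in_K_ob
    (fun X Y f => exist _ (K0_in_K_fun f) (K0_in_K_subproof f)) _ _.
Next Obligation. exact: KhomP. Qed.
Next Obligation. exact: KhomP. Qed.

(* The object W(X)/T is represented by the pair (X, T). *)
Record Cob := COb {
  cvars : {fset X0};
  ccong : set (W cvars * W cvars);
  ccong_closed : closed_cong H ccong }.
Arguments ccong : clear implicits.

Definition Calg (O : Cob) : lieAlgType P := quotLie (ccong_closed O).

Definition C : category :=
  @Category Cob (fun O1 O2 => lieHom (Calg O1) (Calg O2))
    (fun O => lie_id (Calg O))
    (fun _ _ _ g f => lie_comp g f) (fun _ _ _ _ h g f => lie_compA h g f)
    (fun _ _ f => lie_comp1f f) (fun _ _ f => lie_compf1 f).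

Definition Cpi (O : Cob) : lieHom (W (cvars O)) (Calg O) :=
  quot_pi (ccong_closed O).

Lemma Chom_lift (O1 O2 : Cob) (h : lieHom (Calg O1) (Calg O2)) :
  exists s : lieHom (W (cvars O1)) (W (cvars O2)),
    lie_comp (Cpi O2) s = lie_comp h (Cpi O1).
Proof.
have /choice [f hf] : forall x : cvars O1,
    exists w : W (cvars O2), Cpi O2 w = h (Cpi O1 (gen P x)).
  by move=> x; exact: quot_pi_surj.
exists (free_ext f); apply: free_hom_ext => x.
by rewrite -[RHS]hf -(free_ext_gen f).
Qed.

Lemma closed_kernel (W' : lieAlgType P) (A : set (lieHom W' H)) :
  closed_cong H (kernel A).
Proof. by exists A. Qed.

Lemma algebraic_solutions (W' : lieAlgType P) (T : set (W' * W')) :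
  algebraic (solutions H T).
Proof. by exists T. Qed.

Definition K_to_C_ob (O : Kob) : Cob := COb (closed_kernel (kset O)).

Lemma K_to_C_hom_subproof (O1 O2 : Kob) (f : Khom O1 O2)
    (s : lieHom (W (kvars O2)) (W (kvars O1))) :
  (forall nu, sval (sval f nu) = lie_comp (sval nu) s) ->
  forall x y, ccong (K_to_C_ob O2) (x, y) ->
    lie_comp (Cpi (K_to_C_ob O1)) s x = lie_comp (Cpi (K_to_C_ob O1)) s y.
Proof.
move=> fs x y xy; apply/quot_piP => nu Anu; rewrite /Ker /=.
have := fs (exist _ nu Anu); case: (sval f _) => mu Bmu /= muE.
by have := xy _ Bmu; rewrite /Ker /= muE.
Qed.

(* The morphism [s] : (X, A) -> (Y, B) is sent to the homomorphism
   W(Y)/B' -> W(X)/A' induced by s; it does not depend on the choice of s. *)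
Definition K_to_C_hom (O1 O2 : Kob) (f : Khom O1 O2) :
    lieHom (Calg (K_to_C_ob O2)) (Calg (K_to_C_ob O1)) :=
  quot_lift (ccong_closed (K_to_C_ob O2))
    (K_to_C_hom_subproof (projT2 (cid (svalP f)))).

Lemma K_to_C_homE (O1 O2 : Kob) (f : Khom O1 O2)
    (s : lieHom (W (kvars O2)) (W (kvars O1))) :
  (forall nu, sval (sval f nu) = lie_comp (sval nu) s) ->
  lie_comp (K_to_C_hom f) (Cpi (K_to_C_ob O2))
  = lie_comp (Cpi (K_to_C_ob O1)) s.
Proof.
move=> fs; rewrite [LHS]quot_liftK; apply: lieHomP => w.
apply/quot_piP => nu Anu; rewrite /Ker /=.
have := fs (exist _ nu Anu); rewrite (projT2 (cid (svalP f))) /=.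
by move=> /(congr1 (fun h : lieHom _ _ => h w)).
Qed.

Lemma K_to_C_hom1 (O : Kob) : K_to_C_hom (Kid O) = lie_id (Calg (K_to_C_ob O)).
Proof.
apply: quot_hom_ext; rewrite [LHS](K_to_C_homE (s := lie_id _)).
  by rewrite lie_comp1f lie_compf1.
by move=> nu; rewrite lie_compf1.
Qed.

Lemma K_to_C_homM (O1 O2 O3 : Kob) (g : Khom O2 O3) (f : Khom O1 O2) :
  K_to_C_hom (Kcomp g f) = lie_comp (K_to_C_hom f) (K_to_C_hom g).
Proof.
have [s fs] := svalP f; have [t gt] := svalP g.
apply: quot_hom_ext; rewrite [LHS](K_to_C_homE (s := lie_comp s t)); last first.
  by move=> nu /=; rewrite gt fs lie_compA.
rewrite lie_compA -(K_to_C_homE fs) -!lie_compA; congr lie_comp.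
exact/esym/K_to_C_homE.
Qed.

Definition K_to_C : functor K (op_cat C) :=
  @Functor K (op_cat C) K_to_C_ob K_to_C_hom K_to_C_hom1
    (fun _ _ _ g f => K_to_C_homM g f).

Definition C_to_K_ob (O : Cob) : Kob := KOb (algebraic_solutions (ccong O)).

Section CtoKHom.
Variables (O1 O2 : Cob) (h : lieHom (Calg O1) (Calg O2)).

Lemma C_to_K_factor (nu : {nu | kset (C_to_K_ob O2) nu}) x y :
  ccong O2 (x, y) -> sval nu x = sval nu y.
Proof. exact: (svalP nu (x, y)). Qed.

(* nu factors as nubar : W(Y)/T -> H, and is sent to nubar h pi. *)
Definition C_to_K_val (nu : {nu | kset (C_to_K_ob O2) nu}) :
    lieHom (W (cvars O1)) H :=
  lie_comp (lie_comp (quot_lift (ccong_closed O2) (C_to_K_factor nu)) h) (Cpi O1).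

Lemma C_to_K_valP nu : kset (C_to_K_ob O1) (C_to_K_val nu).
Proof.
move=> [x y] xy; rewrite /Ker /=.
have xy' : Cpi O1 x = Cpi O1 y by apply/quot_piP.
exact: (congr1 (fun z => quot_lift _ (C_to_K_factor nu) (h z)) xy').
Qed.

Definition C_to_K_fun (nu : {nu | kset (C_to_K_ob O2) nu}) :
    {nu | kset (C_to_K_ob O1) nu} := exist _ (C_to_K_val nu) (C_to_K_valP nu).

Lemma C_to_K_valE s nu : lie_comp (Cpi O2) s = lie_comp h (Cpi O1) ->
  C_to_K_val nu = lie_comp (sval nu) s.
Proof.
move=> hs; rewrite /C_to_K_val -lie_compA -hs lie_compA.
by congr lie_comp; exact: quot_liftK.
Qed.

Lemma C_to_K_subproof :
  exists s : lieHom (W (cvars O1)) (W (cvars O2)),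
    forall nu, sval (C_to_K_fun nu) = lie_comp (sval nu) s.
Proof. by have [s hs] := Chom_lift h; exists s => nu; exact: C_to_K_valE. Qed.

Definition C_to_K_hom : Khom (C_to_K_ob O2) (C_to_K_ob O1) :=
  exist _ C_to_K_fun C_to_K_subproof.

End CtoKHom.

Lemma C_to_K_hom1 (O : Cob) : C_to_K_hom (lie_id (Calg O)) = Kid (C_to_K_ob O).
Proof.
apply: KhomP => nu /=; rewrite (C_to_K_valE (s := lie_id _)) ?lie_compf1 //.
by rewrite lie_comp1f.
Qed.

Lemma C_to_K_homM (O1 O2 O3 : Cob) (g : lieHom (Calg O2) (Calg O3))
    (f : lieHom (Calg O1) (Calg O2)) :
  C_to_K_hom (lie_comp g f) = Kcomp (C_to_K_hom f) (C_to_K_hom g).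
Proof.
have [s fs] := Chom_lift f; have [t gt] := Chom_lift g.
apply: KhomP => nu /=; rewrite (C_to_K_valE _ fs) /= (C_to_K_valE _ gt).
rewrite (C_to_K_valE (s := lie_comp t s)) ?lie_compA //.
by rewrite gt -lie_compA fs lie_compA.
Qed.

Definition C_to_K : functor (op_cat C) K :=
  @Functor (op_cat C) K C_to_K_ob (fun _ _ f => C_to_K_hom f) C_to_K_hom1
    (fun _ _ _ g f => C_to_K_homM f g).

Section Theta0InC.
Hypothesis VarH : forall L : lieAlgType P, Var H L.

Lemma trivial_closed (X : {fset X0}) :
  closed_cong H [set p : W X * W X | p.1 = p.2].
Proof.
exists setT; apply/seteqP; split => [[x y] /= -> nu _ //|[x y] /= xy].
rewrite -[x](lreprK (hR := @term_eq_cong P X)) -[y](lreprK (hR := @term_eq_cong P X)).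
set t := lrepr x; set u := lrepr y.
pose ren (x : X) : lieTerm P nat := TVar (enum_rank x : nat).
pose fix sub (t : lieTerm P X) : lieTerm P nat :=
  match t with
  | TVar x => ren x
  | TZero => TZero
  | TOpp t => TOpp (sub t)
  | TAdd t u => TAdd (sub t) (sub u)
  | TScale a t => TScale a (sub t)
  | TBracket t u => TBracket (sub t) (sub u)
  end.
have subE (L : lieAlgType P) (f : nat -> L) v :
    teval f (sub v) = teval (fun x : X => f (enum_rank x : nat)) v.
  by elim: v => //= [v ->|v -> w ->|a v ->|v -> w ->].
have : models [set e | satisfies H e] (W X).
  apply: VarH; last by move=> e; apply.
  by exists [set e | satisfies H e].
have eH : satisfies H (sub t, sub u).
  move=> f /=; rewrite !subE.
  set g := fun x : X => f (enum_rank x : nat).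
  by move: (xy (free_ext g) I).
move=> /(_ (sub t, sub u) eH).
pose f (n : nat) : W X :=
  oapp (fun i : 'I_#|{: X}| => gen P (enum_val i)) 0 (insub n).
move=> /(_ f) /=; rewrite !subE.
have -> : (fun x : X => f (enum_rank x : nat)) = @gen P X.
  by apply/funext => z; rewrite /f valK /= enum_rankK.
by rewrite !teval_gen.
Qed.

Definition Theta0_in_C_ob (X : {fset X0}) : Cob := COb (trivial_closed X).

Lemma Theta0_in_C_subproof (X Y : {fset X0}) (s : lieHom (W X) (W Y)) x y :
  ccong (Theta0_in_C_ob X) (x, y) ->
  lie_comp (Cpi (Theta0_in_C_ob Y)) s x = lie_comp (Cpi (Theta0_in_C_ob Y)) s y.
Proof. by move=> /= ->. Qed.

(* W(X) is identified with its quotient by the equality relation. *)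
Definition Theta0_in_C_hom (X Y : {fset X0}) (s : lieHom (W X) (W Y)) :
    lieHom (Calg (Theta0_in_C_ob X)) (Calg (Theta0_in_C_ob Y)) :=
  quot_lift (ccong_closed (Theta0_in_C_ob X)) (Theta0_in_C_subproof s).

Lemma Theta0_in_C_homE (X Y : {fset X0}) (s : lieHom (W X) (W Y)) :
  lie_comp (Theta0_in_C_hom s) (Cpi (Theta0_in_C_ob X))
  = lie_comp (Cpi (Theta0_in_C_ob Y)) s.
Proof. exact: quot_liftK. Qed.

Lemma Theta0_in_C_hom1 (X : {fset X0}) :
  Theta0_in_C_hom (lie_id (W X)) = lie_id (Calg (Theta0_in_C_ob X)).
Proof.
by apply: quot_hom_ext; rewrite [LHS]Theta0_in_C_homE lie_comp1f lie_compf1.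
Qed.

Lemma Theta0_in_C_homM (X Y Z : {fset X0}) (t : lieHom (W Y) (W Z))
    (s : lieHom (W X) (W Y)) :
  Theta0_in_C_hom (lie_comp t s)
  = lie_comp (Theta0_in_C_hom t) (Theta0_in_C_hom s).
Proof.
apply: quot_hom_ext; rewrite [LHS]Theta0_in_C_homE -lie_compA.
by rewrite [in RHS]Theta0_in_C_homE !lie_compA Theta0_in_C_homE.
Qed.

Definition Theta0_in_C : functor Theta0 C :=
  @Functor Theta0 C Theta0_in_C_ob (fun _ _ s => Theta0_in_C_hom s)
    Theta0_in_C_hom1 (fun _ _ _ t s => Theta0_in_C_homM t s).

End Theta0InC.

End Categories.

Section Correct.
Variables (P : fieldType) (X0 : choiceType).

(* The functor on the categories of quotients of free algebras corresponding to
   F: the conjugate of F by the dualities. *)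
Definition dual_functor (H1 H2 : lieAlgType P) (F : functor (K X0 H1) (K X0 H2)) :
    functor (C X0 H1) (C X0 H2) :=
  unop_functor (comp_functor (K_to_C X0 H2) (comp_functor F (C_to_K X0 H1))).

(* (X1, A1) and (X2, A2) are related when X1 = X2 and A1 is included in A2. *)
Inductive Ksub (H : lieAlgType P) : K X0 H -> K X0 H -> Prop :=
| KSub (X : {fset X0}) (A B : set (lieHom (freeLie P X) H))
    (hA : algebraic A) (hB : algebraic B) :
    A `<=` B -> Ksub (KOb hA) (KOb hB).

Definition preserves_inclusion (H1 H2 : lieAlgType P)
    (F : functor (K X0 H1) (K X0 H2)) : Prop :=
  forall O1 O2 : K X0 H1, Ksub O1 O2 -> Ksub (F O1) (F O2).

Variables (H1 H2 : lieAlgType P).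
Hypotheses (VarH1 : forall L : lieAlgType P, Var H1 L)
  (VarH2 : forall L : lieAlgType P, Var H2 L).

Definition correct_isomorphism (F : functor (K X0 H1) (K X0 H2)) : Prop :=
  [/\ is_iso F,
      exists phi : functor (Theta0 P X0) (Theta0 P X0),
        is_iso phi /\
        induces (Theta0_in_C X0 VarH1) (Theta0_in_C X0 VarH2)
          (dual_functor F) phi,
      exists F0 : functor (K0 X0 H1) (K0 X0 H2),
        is_iso F0 /\ induces (K0_in_K X0 H1) (K0_in_K X0 H2) F F0 &
      preserves_inclusion F].

Definition correct_equivalence (F1 : functor (K X0 H1) (K X0 H2))
    (F2 : functor (K X0 H2) (K X0 H1)) : Prop :=
  [/\ is_equivalence F1 F2,
      exists phi psi : functor (Theta0 P X0) (Theta0 P X0),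
        [/\ induces (Theta0_in_C X0 VarH1) (Theta0_in_C X0 VarH2)
              (dual_functor F1) phi,
            induces (Theta0_in_C X0 VarH2) (Theta0_in_C X0 VarH1)
              (dual_functor F2) psi &
            is_equivalence phi psi],
      exists (G1 : functor (K0 X0 H1) (K0 X0 H2))
             (G2 : functor (K0 X0 H2) (K0 X0 H1)),
        [/\ induces (K0_in_K X0 H1) (K0_in_K X0 H2) F1 G1,
            induces (K0_in_K X0 H2) (K0_in_K X0 H1) F2 G2 &
            is_equivalence G1 G2],
      preserves_inclusion F1 &
      preserves_inclusion F2].

Definition correctly_isomorphic : Prop := exists F, correct_isomorphism F.

Definition correctly_equivalent : Prop :=
  exists F1 F2, correct_equivalence F1 F2.

End Correct.

Arguments kset {P X0 H} _ _.
Arguments ccong {P X0 H} _ _.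
Arguments geom_equiv {P} X0 H1 H2.
Arguments twisted_geom_equiv {P} X0 H1 H2.
Arguments correctly_isomorphic {P} X0 {H1 H2} VarH1 VarH2.
Arguments correctly_equivalent {P} X0 {H1 H2} VarH1 VarH2.

(* Main.v *)
Require Import Defs.
From HB Require Import structures.
From mathcomp Require Import all_boot all_algebra.
From mathcomp Require Import finmap zify.
From mathcomp Require Import boolp classical_sets functions cardinality.

Set Implicit Arguments.
Unset Strict Implicit.
Unset Printing Implicit Defensive.

Import GRing.Theory.
Local Open Scope ring_scope.
Local Open Scope classical_set_scope.
(* Finite-dimensional vector spaces come with a notion of the same name. *)
Local Notation hom := Defs.hom.

(** The easy half is the construction of an isomorphism from a twisted
geometrical equivalence. A field automorphism s acts on the coefficients of
every W(X); conjugating homomorphisms by this action, and moving closed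
congruences by it, is functorial, fixes the underlying variables, and is
inverted by the action of the inverse of s. Since the functor so obtained is
strictly invertible and so are its restrictions, it witnesses both correct
isomorphism and correct equivalence ([twisted_correctly_isomorphic],
[twisted_correctly_equivalent]).

Conversely, let F : K(H1) -> K(H2) belong to a correct isomorphism or
equivalence. Because H1 and H2 generate the variety, a morphism of K0(H) is the
same thing as a homomorphism of free algebras in the opposite direction, so
the restriction of F to K0(H1) is an autoequivalence phi of Theta0. The heart of
the matter is that phi is semi-inner ([autoequivalence_semi_inner]): there are a
field automorphism s and s-semilinear bijections tau_X : W(X) -> W(phi X),
compatible with brackets, such that phi(f) tau_X = tau_Y f. Closed congruences
of W(X) are exactly the sets of pairs (a, b) that become equal after composing with some
morphism g : O -> Hom(W(X), H) of K(H). Equivalences respect this description, so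
tau_X transports H1-closed congruences to H2-closed ones and conversely
([closed_transfer]); as tau_X is semilinear, that is geometrical equivalence of
the twist of H1 by s with H2.

Why phi is semi-inner. The free algebra of rank one is recognised by its
endomorphism monoid, which is commutative and not trivial; elements of W(X) are
the homomorphisms W(x0) -> W(X), so phi induces bijections W(X) -> W(phi X).
The image of W(x, y) is generated by the images of x and y, hence under
these bijections addition, bracket and scalars of W(X) become operations given by
fixed words: a scalar becomes another scalar, addition a two-letter word w_+ and
the bracket a two-letter word w_B. The operations that these words define satisfy
the axioms of Lie algebras on every Lie algebra, and it remains to see that w_+ = x + y ([group_word_add]) and
w_B = c [x, y] ([bilinear_word_bracket]); then tau is c times the given bijection.

Both identities may be tested on modules, since an element of a free Lie algebra
that annihilates every module is zero ([free_lie_faithful], proved by Lazard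
elimination and coinduced modules). For operators A, B on M, let (A, m) denote
the affine operator v |-> A v + m, realised linearly on the direct sum of M and
the line. Any word w satisfies
w((A, A e), (B, B e)) = (w(A, B), w(A, B) e), because (A, A e) is the conjugate of
(A, 0) by a translation; so w(A, B) is known once w is known on affine operators.
- For w_+, the elements (A, 0) and (0, n) combine to (A, f(A) n), with f a
  polynomial that depends on w_+ only. Since w_+ is a group law, f(t) is onto on the
  module P[t], so f is a constant, namely 1; associativity and commutativity then
  give w_+((A, m), (B, n)) = (w_+(A, B), m + n), and w_+(A, B) e = A e + B e.
- For w_B, additivity gives w_B(A, B) e = g(A) B e - g(B) A e for a polynomial g, and
  additivity in A makes g additive on non-commuting operators, so g = c t. *)

(** * Lie algebras, free Lie algebras and their modules *)

(* Simplification must not replace values of homomorphisms by evaluations of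
   representatives. *)
#[global] Opaque free_ext.
Arguments gen : simpl never.

Lemma lie_compE (P : fieldType) (A B C : lieAlgType P) (g : lieHom B C)
  (f : lieHom A B) x : lie_comp g f x = g (f x).
Proof. by []. Qed.

Section Bracket.
Variables (P : fieldType) (L : lieAlgType P).
Implicit Types x y z : L.

Lemma bracketDl x y z : bracket (x + y) z = bracket x z + bracket y z.
Proof. by rewrite -[x]scale1r bracket_linl !scale1r. Qed.

Lemma bracketDr x y z : bracket x (y + z) = bracket x y + bracket x z.
Proof. by rewrite -[y]scale1r bracket_linr !scale1r. Qed.

Lemma bracket0l x : bracket 0 x = 0.
Proof. by apply: (addrI (bracket 0 x)); rewrite -bracketDl !addr0. Qed.

Lemma bracket0r x : bracket x 0 = 0.
Proof. by apply: (addrI (bracket x 0)); rewrite -bracketDr !addr0. Qed.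

Lemma bracketZl a x y : bracket (a *: x) y = a *: bracket x y.
Proof. by have := bracket_linl a x 0 y; rewrite bracket0l !addr0. Qed.

Lemma bracketZr a x y : bracket x (a *: y) = a *: bracket x y.
Proof. by have := bracket_linr a x y 0; rewrite bracket0r !addr0. Qed.

Lemma bracketC x y : bracket x y = - bracket y x.
Proof.
apply/eqP; rewrite -addr_eq0; apply/eqP.
have := bracketxx (x + y).
by rewrite bracketDl !bracketDr !bracketxx add0r addr0.
Qed.

Lemma bracketNr x y : bracket x (- y) = - bracket x y.
Proof. by rewrite -scaleN1r bracketZr scaleN1r. Qed.

Lemma bracket_leibniz x y z :
  bracket x (bracket y z) = bracket (bracket x y) z + bracket y (bracket x z).
Proof.
apply/eqP; rewrite [bracket (bracket x y) z]bracketC [bracket x z]bracketC.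
by rewrite bracketNr -opprD -addr_eq0 [bracket z _ + _]addrC jacobi.
Qed.

End Bracket.

Lemma free_ind (P : fieldType) (V : Type) (Q : freeLie P V -> Prop) :
  (forall x, Q (gen P x)) -> Q 0 -> (forall u v, Q u -> Q v -> Q (u + v)) ->
  (forall a u, Q u -> Q (a *: u)) ->
  (forall u v, Q u -> Q v -> Q (bracket u v)) -> forall u, Q u.
Proof.
move=> Qg Q0 QD QZ QB u; rewrite -[u](lreprK (hR := @term_eq_cong P V)).
rewrite -teval_gen; elim: (lrepr u) => //= [t Qt|t Qt v Qv|a t Qt|t Qt v Qv].
- by rewrite -scaleN1r; apply: QZ.
- exact: QD.
- exact: QZ.
- exact: QB.
Qed.

Section ZeroHom.
Variables (P : fieldType) (A B : lieAlgType P).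

Lemma lie_zero_linear (a : P) (x y : A) : (0 : B) = a *: 0 + 0.
Proof. by rewrite scaler0 addr0. Qed.

Lemma lie_zero_bracket (x y : A) : (0 : B) = bracket 0 0.
Proof. by rewrite bracketxx. Qed.

Definition lie_zero : lieHom A B := LieHom lie_zero_linear lie_zero_bracket.
End ZeroHom.

Section GL.
Variables (P : fieldType) (M : lmodType P).

(** Linear endomorphisms of a module of any dimension; a module over the free Lie
    algebra on V is a map from V to these. *)
Record gl := Gl {
  gl_fun :> M -> M;
  gl_linear : forall a x y, gl_fun (a *: x + y) = a *: gl_fun x + gl_fun y }.

HB.instance Definition _ := gen_eqMixin gl.
HB.instance Definition _ := gen_choiceMixin gl.

Lemma glP (f g : gl) : f =1 g -> f = g.
Proof.
case: f g => [f f1] [g g1] /= /funext fg.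
by subst g; congr Gl; exact: Prop_irrelevance.
Qed.

Lemma glD (f : gl) x y : f (x + y) = f x + f y.
Proof. by have := gl_linear f 1 x y; rewrite !scale1r. Qed.

Lemma gl0 (f : gl) : f 0 = 0.
Proof. by apply: (addrI (f 0)); rewrite -glD !addr0. Qed.

Lemma glZ (f : gl) a x : f (a *: x) = a *: f x.
Proof. by have := gl_linear f a x 0; rewrite gl0 !addr0. Qed.

Lemma glN (f : gl) x : f (- x) = - f x.
Proof. by rewrite -scaleN1r glZ scaleN1r. Qed.

Let zero_lin a (x y : M) : (0 : M) = a *: 0 + 0.
Proof. by rewrite scaler0 addr0. Qed.

Let opp_lin (f : gl) a x y : - f (a *: x + y) = a *: - f x + - f y.
Proof. by rewrite gl_linear opprD scalerN. Qed.

Let add_lin (f g : gl) a x y :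
  f (a *: x + y) + g (a *: x + y) = a *: (f x + g x) + (f y + g y).
Proof. by rewrite !gl_linear scalerDr addrACA. Qed.

Let scale_lin b (f : gl) a x y : b *: f (a *: x + y) = a *: (b *: f x) + b *: f y.
Proof. by rewrite gl_linear scalerDr !scalerA mulrC. Qed.

Let bracket_lin (f g : gl) a x y :
  f (g (a *: x + y)) - g (f (a *: x + y))
  = a *: (f (g x) - g (f x)) + (f (g y) - g (f y)).
Proof. by rewrite !gl_linear scalerBr opprD addrACA. Qed.

Let glzero := Gl zero_lin.
Let glopp f := Gl (opp_lin f).
Let gladd f g := Gl (add_lin f g).
Let glscale b f := Gl (scale_lin b f).
Let glbracket f g := Gl (bracket_lin f g).

Let addA : associative gladd.
Proof. by move=> f g h; apply: glP => x /=; rewrite addrA. Qed.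
Let addC : commutative gladd.
Proof. by move=> f g; apply: glP => x /=; rewrite addrC. Qed.
Let add0 : left_id glzero gladd.
Proof. by move=> f; apply: glP => x /=; rewrite add0r. Qed.
Let addN : left_inverse glzero glopp gladd.
Proof. by move=> f; apply: glP => x /=; rewrite addNr. Qed.

HB.instance Definition _ := GRing.isZmodule.Build gl addA addC add0 addN.

Let scaleA a b f : glscale a (glscale b f) = glscale (a * b) f.
Proof. by apply: glP => x /=; rewrite scalerA. Qed.
Let scale1 : left_id 1 glscale.
Proof. by move=> f; apply: glP => x /=; rewrite scale1r. Qed.
Let scaleDr : right_distributive glscale +%R.
Proof. by move=> a f g; apply: glP => x /=; rewrite scalerDr. Qed.
Let scaleDl f : {morph glscale^~ f : a b / a + b}.
Proof. by move=> a b; apply: glP => x /=; rewrite scalerDl. Qed.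

HB.instance Definition _ :=
  GRing.Zmodule_isLmodule.Build P gl scaleA scale1 scaleDr scaleDl.

Let blinl a f g h : glbracket (a *: f + g) h = a *: glbracket f h + glbracket g h.
Proof.
by apply: glP => x /=; rewrite gl_linear scalerBr opprD addrACA.
Qed.
Let blinr a f g h : glbracket f (a *: g + h) = a *: glbracket f g + glbracket f h.
Proof.
by apply: glP => x /=; rewrite gl_linear scalerBr opprD addrACA.
Qed.
Let bxx f : glbracket f f = 0.
Proof. by apply: glP => x /=; rewrite subrr. Qed.
Let bjacobi f g h :
  glbracket f (glbracket g h)
  + (glbracket g (glbracket h f) + glbracket h (glbracket f g)) = 0.
Proof.
apply: glP => x /=; rewrite !glD !glN.
rewrite !opprD !opprK !addrA.
rewrite (ACl ((1*11)*(2*8)*(3*5)*(4*10)*(6*12)*(7*9)))%AC /=.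
by rewrite !(subrr, addNr, addr0).
Qed.

HB.instance Definition _ :=
  Lmodule_isLieAlgebra.Build P gl blinl blinr bxx bjacobi.

Lemma gl_addE (f g : gl) x : (f + g) x = f x + g x.
Proof. by []. Qed.

Lemma gl_zeroE x : (0 : gl) x = 0.
Proof. by []. Qed.

Lemma gl_scaleE a (f : gl) x : (a *: f) x = a *: f x.
Proof. by []. Qed.

Lemma gl_bracketE (f g : gl) x : bracket f g x = f (g x) - g (f x).
Proof. by []. Qed.

End GL.

Lemma free_ext_comp (P : fieldType) (V : Type) (A B : lieAlgType P)
    (h : lieHom A B) (f : V -> A) u :
  h (free_ext f u) = free_ext (h \o f) u.
Proof.
have -> : free_ext (h \o f) = lie_comp h (free_ext f).
  by apply: free_hom_ext => x; rewrite free_ext_gen lie_compE free_ext_gen.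
by [].
Qed.

Lemma free_ext0 (P : fieldType) (V : Type) (A : lieAlgType P) u :
  free_ext (fun _ : V => 0 : A) u = 0.
Proof.
have -> : free_ext (fun _ : V => 0 : A) = lie_zero _ _.
  by apply: free_hom_ext => x; rewrite free_ext_gen.
by [].
Qed.

(** Words in operators commute with module homomorphisms. All computations of
    words below pass between modules in this way. *)
Lemma intertwine (P : fieldType) (V : Type) (M N : lmodType P)
    (rho : V -> gl M) (pi : V -> gl N) (theta : {linear M -> N}) :
  (forall x m, theta (rho x m) = pi x (theta m)) ->
  forall u m, theta (free_ext rho u m) = free_ext pi u (theta m).
Proof.
move=> h; apply: free_ind => [x m|m|u v hu hv m|a u hu m|u v hu hv m].
- by rewrite !free_ext_gen.
- by rewrite !lieHom0 !gl_zeroE linear0.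
- by rewrite !lieHomD !gl_addE linearD hu hv.
- by rewrite !lieHomZ !gl_scaleE linearZ hu.
- by rewrite !lie_bracket !gl_bracketE linearB /= hu hv hv hu.
Qed.

(** * Free Lie algebras act faithfully on their modules *)

Inductive tree (V : Type) := Leaf of V | Node of tree V & tree V.

Fixpoint tree_size V (t : tree V) : nat :=
  match t with Leaf _ => 1%N | Node t u => (tree_size t + tree_size u)%N end.

Fixpoint occurs (V : eqType) (x : V) (t : tree V) : bool :=
  match t with Leaf y => y == x | Node t u => occurs x t || occurs x u end.

Lemma tree_size_gt0 V (t : tree V) : (0 < tree_size t)%N.
Proof. by elim: t => //= t ht u hu; rewrite addn_gt0 ht. Qed.

Lemma occurs_ex (V : eqType) (t : tree V) : exists x, occurs x t.
Proof.
by elim: t => [x|t [x xt] u _] /=; exists x; rewrite ?eqxx ?xt.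
Qed.

Section Span.
Variables (P : fieldType) (V : Type).

Fixpoint tree_val (t : tree V) : freeLie P V :=
  match t with
  | Leaf x => gen P x
  | Node t u => bracket (tree_val t) (tree_val u)
  end.

Definition tree_sum (l : seq (P * tree V)) : freeLie P V :=
  \sum_(p <- l) p.1 *: tree_val p.2.

Definition sum_scale (a : P) (l : seq (P * tree V)) :=
  [seq (a * p.1, p.2) | p <- l].

Definition sum_bracket (l m : seq (P * tree V)) :=
  [seq (p.1 * q.1, Node p.2 q.2) | p <- l, q <- m].

Lemma tree_sum_nil : tree_sum [::] = 0.
Proof. exact: big_nil. Qed.

Lemma tree_sum_cons p l : tree_sum (p :: l) = p.1 *: tree_val p.2 + tree_sum l.
Proof. exact: big_cons. Qed.

Lemma tree_sum1 t : tree_sum [:: (1, t)] = tree_val t.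
Proof. by rewrite tree_sum_cons tree_sum_nil scale1r addr0. Qed.

Lemma tree_sum_cat l m : tree_sum (l ++ m) = tree_sum l + tree_sum m.
Proof. exact: big_cat. Qed.

Lemma tree_sum_scale a l : tree_sum (sum_scale a l) = a *: tree_sum l.
Proof.
elim: l => [|p l IHl]; first by rewrite !tree_sum_nil scaler0.
by rewrite /= !tree_sum_cons IHl scalerDr scalerA.
Qed.

Lemma tree_sum_bracket l m :
  tree_sum (sum_bracket l m) = bracket (tree_sum l) (tree_sum m).
Proof.
elim: l => [|p l IHl]; first by rewrite !tree_sum_nil bracket0l.
rewrite /sum_bracket /= tree_sum_cat -/(sum_bracket l m) IHl tree_sum_cons bracketDl.
congr (_ + _); elim: m {IHl} => [|q m IHm] /=.
  by rewrite !tree_sum_nil bracket0r.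
by rewrite !tree_sum_cons IHm bracketDr /= !bracketZl bracketZr scalerA.
Qed.

Lemma tree_sum_surj u : exists l, u = tree_sum l.
Proof.
elim/free_ind: u => [x||u v [l ->] [m ->]|a u [l ->]|u v [l ->] [m ->]].
- by exists [:: (1, Leaf x)]; rewrite tree_sum1.
- by exists [::]; rewrite tree_sum_nil.
- by exists (l ++ m); rewrite tree_sum_cat.
- by exists (sum_scale a l); rewrite tree_sum_scale.
- by exists (sum_bracket l m); rewrite tree_sum_bracket.
Qed.

Definition sizes_le n (l : seq (P * tree V)) := all (fun p => tree_size p.2 <= n)%N l.

Lemma sizes_le_scale n a l : sizes_le n (sum_scale a l) = sizes_le n l.
Proof. by rewrite /sizes_le all_map. Qed.

Lemma sizes_le_bracket m n l l' :
  sizes_le m l -> sizes_le n l' -> sizes_le (m + n) (sum_bracket l l').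
Proof.
elim: l => //= p l IH /andP[hp hl] hl'.
rewrite /sum_bracket /= /sizes_le all_cat; apply/andP; split; last exact: IH.
by rewrite all_map; apply: sub_all hl' => q /= hq; exact: leq_add.
Qed.

Lemma sizes_le_trans m n l : (m <= n)%N -> sizes_le m l -> sizes_le n l.
Proof. by move=> mn; apply: sub_all => p /= /leq_trans; apply. Qed.

End Span.
Arguments tree_val P {V} t.

Section Elimination.
Variables (P : fieldType) (V : eqType) (x : V).

(** The letter (y, i) stands for the i-fold bracket [x, ..., [x, y]]. This is Lazard's
    elimination: every element of W(V) is a multiple of x plus an element of the
    subalgebra generated by these letters, and a tree in which x occurs becomes
    shorter in them. *)
Definition elim_letter : Type := ({y : V | y != x} * nat)%type.

Definition ad_letter (p : elim_letter) : freeLie P V :=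
  iter p.2 (bracket (gen P x)) (gen P (val p.1)).

Local Notation V' := elim_letter.
Local Notation iota := (free_ext ad_letter).

(** By the Leibniz rule the bracket with x acts as the derivation
    (y, i) |-> (y, i + 1), which does not change sizes. *)
Lemma ad_elim (t : tree V') : exists l : seq (P * tree V'),
  sizes_le (tree_size t) l /\
  bracket (gen P x) (iota (tree_val P t)) = iota (tree_sum l).
Proof.
elim: t => [[y i]|t [l [hl tl]] u [m [hm um]]] /=.
  exists [:: (1, Leaf (y, i.+1))]; split => //.
  by rewrite tree_sum1 /= !free_ext_gen.
exists (sum_bracket l [:: (1, u)] ++ sum_bracket [:: (1, t)] m); split.
  rewrite /sizes_le all_cat; apply/andP; split.
    by apply: sizes_le_bracket => //=; rewrite andbT.
  by apply: sizes_le_bracket => //=; rewrite andbT.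
rewrite tree_sum_cat !tree_sum_bracket !tree_sum1 lieHomD !lie_bracket.
by rewrite bracket_leibniz tl um.
Qed.

Lemma ad_elim_list n (l : seq (P * tree V')) : sizes_le n l ->
  exists l' : seq (P * tree V'),
    sizes_le n l' /\ bracket (gen P x) (iota (tree_sum l)) = iota (tree_sum l').
Proof.
elim: l => [_|[a t] l IH /= /andP[ht /IH[l' [hl' ll']]]].
  by exists [::]; rewrite tree_sum_nil !lieHom0 bracket0r.
have [m [hm tm]] := ad_elim t.
exists (sum_scale a m ++ l'); split.
  by rewrite /sizes_le all_cat -/(sizes_le _ _) sizes_le_scale (sizes_le_trans ht).
rewrite tree_sum_cons tree_sum_cat tree_sum_scale !lieHomD !lieHomZ.
by rewrite bracketDr bracketZr tm ll'.
Qed.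

(** Rewriting in the new letters shortens exactly the trees in which x occurs, an
    occurrence of x being absorbed in the index of a letter. *)
Lemma elim_tree (t : tree V) : exists (a : P) (l : seq (P * tree V')),
  tree_val P t = a *: gen P x + iota (tree_sum l) /\
  if occurs x t then is_true (sizes_le (tree_size t).-1 l)
  else a = 0 /\ exists t', tree_size t' = tree_size t /\ l = [:: (1, t')].
Proof.
elim: t => [y|t [a [l [tE hl]]] u [b [m [uE hm]]]] /=.
  case: (eqVneq y x) => [->|yx].
    by exists 1, [::]; rewrite tree_sum_nil lieHom0 addr0 scale1r.
  exists 0, [:: (1, Leaf (exist _ y yx, 0%N))].
  rewrite tree_sum1 /= free_ext_gen scale0r add0r; split => //; split => //.
  by exists (Leaf (exist _ y yx, 0%N)).
case: (boolP (occurs x t || occurs x u)) => [xtu|]; last first.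
  rewrite negb_or => /andP[/negbTE xt /negbTE xu]; move: hl hm.
  rewrite xt xu => -[a0 [t' [tt' lE]]] [b0 [u' [uu' mE]]].
  exists 0, [:: (1, Node t' u')]; split.
    rewrite tE uE a0 b0 lE mE !scale0r !add0r !tree_sum1 /=.
    by rewrite lie_bracket.
  by split => //; exists (Node t' u'); rewrite /= tt' uu'.
have hl' : sizes_le (tree_size t - occurs x t) l.
  case: (occurs x t) hl => [|[_ [t' [tt' ->]]]]; first by rewrite subn1.
  by rewrite /sizes_le /= tt' subn0 leqnn.
have hm' : sizes_le (tree_size u - occurs x u) m.
  case: (occurs x u) hm => [|[_ [t' [tt' ->]]]]; first by rewrite subn1.
  by rewrite /sizes_le /= tt' subn0 leqnn.
have [l' [hl'' ll']] := ad_elim_list hl'.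
have [m' [hm'' mm']] := ad_elim_list hm'.
exists 0, (sum_scale a m' ++ sum_scale (- b) l' ++ sum_bracket l m); split.
  rewrite tE uE !tree_sum_cat !tree_sum_scale tree_sum_bracket.
  rewrite !lieHomD !lieHomZ lie_bracket -ll' -mm' bracketDl !bracketDr.
  rewrite !bracketZl !bracketZr bracketxx.
  rewrite !scaler0 add0r scale0r add0r.
  by rewrite scaleNr -scalerN -bracketC addrA.
have := tree_size_gt0 t; have := tree_size_gt0 u => u0 t0.
rewrite /sizes_le !all_cat -!/(sizes_le _ _) !sizes_le_scale.
apply/and3P; split.
- by apply: sizes_le_trans hm''; lia.
- by apply: sizes_le_trans hl''; lia.
- apply: sizes_le_trans (sizes_le_bracket hl' hm').
  by case: (occurs x t) xtu => /=; case: (occurs x u) => //= _; lia.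
Qed.

(** The number of trees of maximal size is what the induction in
    [tree_sum_faithful] decreases. *)
Lemma elim_list N (l : seq (P * tree V)) : sizes_le N l ->
  exists (a : P) (l' : seq (P * tree V')),
  [/\ tree_sum l = a *: gen P x + iota (tree_sum l'), sizes_le N l' &
      (count (fun p => tree_size p.2 == N) l'
       <= count (fun p => (tree_size p.2 == N) && ~~ occurs x p.2) l)%N].
Proof.
elim: l => [_|[c t] l IH /= /andP[ht /IH[a [l' [lE hl' cl']]]]].
  by exists 0, [::]; rewrite !tree_sum_nil lieHom0 scale0r addr0.
have [b [m [tE hm]]] := elim_tree t.
exists (c * b + a), (sum_scale c m ++ l'); split.
- rewrite tree_sum_cons lE tE tree_sum_cat tree_sum_scale lieHomD lieHomZ scalerDr.
  by rewrite addrACA scalerA -scalerDl.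
- rewrite /sizes_le all_cat -!/(sizes_le _ _) sizes_le_scale hl' andbT.
  case: (occurs x t) hm => [|[_ [t' [tt' ->]]]].
    by apply: sizes_le_trans; lia.
  by rewrite /sizes_le /= tt' ht.
- rewrite count_cat; apply: leq_add => //.
  rewrite count_map; case: (occurs x t) hm => [hm|[_ [t' [tt' ->]]]] /=.
    rewrite andbF leqn0; have := tree_size_gt0 t; move: hm => {tE}.
    elim: m => //= p m IHm /andP[hp hm] t0; rewrite (eqP (IHm hm t0)) addn0 eqb0; lia.
  by rewrite tt' andbT addn0.
Qed.

End Elimination.

(** Equivalently, u is killed by the map from the free Lie algebra to the free
    associative algebra. *)
Definition acts_trivially (P : fieldType) (V : Type) (u : freeLie P V) : Prop :=
  forall (M : lmodType P) (rho : V -> gl M), free_ext rho u = 0.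

Section Coinduced.
Variables (P : fieldType) (V : eqType) (x : V) (M : lmodType P).
Variable rho : elim_letter x -> gl M.
Local Notation N := (nat -> M).

Definition shift_fun (f : N) : N := fun n => f n.+1.

Lemma shift_linear a (f g : N) :
  shift_fun (a *: f + g) = a *: shift_fun f + shift_fun g.
Proof. by []. Qed.

Definition shift : gl N := Gl shift_linear.

(** The coinduced module. A sequence f lists the values at the origin of the
    iterates of x, so x acts as the shift; the clauses of the fixpoint are the
    identity [x, (y, i)] = (y, i + 1) and the action of (y, i) at the origin. *)
Fixpoint coind_fun (y : {y : V | y != x}) (i : nat) (f : N) (n : nat) : M :=
  if n is n'.+1 then coind_fun y i.+1 f n' + coind_fun y i (shift_fun f) n'
  else rho (y, i) (f 0%N).

Lemma coind_linear y i a (f g : N) :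
  coind_fun y i (a *: f + g) = a *: coind_fun y i f + coind_fun y i g.
Proof.
apply/funext => n; rewrite -[RHS]/(a *: coind_fun y i f n + coind_fun y i g n).
elim: n i f g => [|n IH] i f g; first exact: gl_linear.
by rewrite /= shift_linear !IH scalerDr addrACA.
Qed.

Definition coind_op y i : gl N := Gl (coind_linear y i).

Lemma shift_coind y i : bracket shift (coind_op y i) = coind_op y i.+1.
Proof.
apply: glP => f; apply/funext => n.
exact: (addrK (coind_fun y i (shift_fun f) n)).
Qed.

Definition coind (z : V) : gl N :=
  if insub z is Some y then coind_op y 0 else shift.

Lemma coind_letter : coind x = shift.
Proof. by rewrite /coind insubF ?eqxx. Qed.

Lemma coind_other (y : {y : V | y != x}) : coind (val y) = coind_op y 0.
Proof. by rewrite /coind valK. Qed.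

Lemma coind_iota p : free_ext coind (ad_letter P p) = coind_op p.1 p.2.
Proof.
case: p => y i; rewrite /ad_letter /=; elim: i => [|i IH] /=.
  by rewrite free_ext_gen coind_other.
by rewrite lie_bracket IH free_ext_gen coind_letter shift_coind.
Qed.

Definition eval0 (f : N) : M := f 0%N.
Lemma eval0_linear : linear eval0. Proof. by []. Qed.
HB.instance Definition _ := GRing.isLinear.Build P N M *:%R eval0 eval0_linear.

(** Every module over the letters (y, i) is thus a quotient, along evaluation at
    the origin, of one in which (y, i) acts as an iterated bracket of x and y. *)
Lemma eval0_coind v f :
  free_ext coind (free_ext (ad_letter P (x := x)) v) f 0%N = free_ext rho v (f 0%N).
Proof.
rewrite free_ext_comp.
apply: (intertwine (theta := eval0)) => p {}f; rewrite /= coind_iota.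
by case: p.
Qed.

End Coinduced.

Lemma gl_scale_linear (P : fieldType) (M : lmodType P) (a b : P) (x y : M) :
  a *: (b *: x + y) = b *: (a *: x) + a *: y.
Proof. by rewrite scalerDr !scalerA mulrC. Qed.

Definition gl_scalar (P : fieldType) (M : lmodType P) (a : P) : gl M :=
  Gl (@gl_scale_linear P M a).

(** The coefficient a is read off the one-dimensional module on which x acts by 1
    and the other letters by 0; coinduced modules take care of v. *)
Lemma acts_trivially_elim (P : fieldType) (V : eqType) (x : V) (a : P)
    (v : freeLie P (elim_letter x)) :
  acts_trivially (a *: gen P x + free_ext (@ad_letter P V x) v) ->
  a = 0 /\ acts_trivially v.
Proof.
move=> h; have a0 : a = 0.
  pose rho (z : V) : gl P^o := gl_scalar _ (z == x)%:R.
  have := h _ rho; rewrite lieHomD lieHomZ free_ext_gen free_ext_comp.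
  have -> : free_ext rho \o ad_letter P (x := x) = fun=> 0.
    apply/funext => -[[y yx] i] /=; rewrite /ad_letter /=.
    elim: i => [|i IH]; last by rewrite /= lie_bracket IH bracket0r.
    rewrite /= free_ext_gen /rho (negbTE yx); apply: glP => z.
    exact: scale0r.
  rewrite free_ext0 addr0 => /(congr1 (fun f : gl _ => f 1)).
  rewrite -[LHS]/(a * ((x == x)%:R * 1)) eqxx !mulr1; exact.
split=> // M rho; apply: glP => m.
have := eval0_coind rho v (fun=> m).
have := h _ (coind rho); rewrite a0 scale0r add0r => ->.
by [].
Qed.

(** Induction on the maximal size n and on the number k of trees of that size. It
    is essential that the alphabet is arbitrary, as elimination changes it. *)
Lemma tree_sum_faithful (P : fieldType) n :
  forall k (V : eqType) (l : seq (P * tree V)),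
  sizes_le n l -> (count (fun p => tree_size p.2 == n) l <= k)%N ->
  acts_trivially (tree_sum l) -> tree_sum l = 0.
Proof.
elim: n => [|n IHn] k V l.
  case: l => [|[a t] l] /=; first by rewrite tree_sum_nil.
  by have := tree_size_gt0 t; case: (tree_size t).
elim: k V l => [|k IHk] V l hl cl.
  apply: (IHn (size l)); last exact: count_size.
  move: hl cl; rewrite leqn0; elim: l => //= p l IH /andP[hp hl].
  by rewrite addn_eq0 => /andP[cp cl]; rewrite IH // andbT; lia.
have [->|[x0 _]] : l = [::] \/ exists x0 : V, True.
- by case: l {hl cl} => [|[c t] l]; [left|right; case: (occurs_ex t) => x; exists x].
- by rewrite tree_sum_nil.
have [x cx] : exists x,
    (count (fun p => (tree_size p.2 == n.+1) && ~~ occurs x p.2) l <= k)%N.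
  elim: l cl {hl} => [|[c t] l IH] /=.
    by move=> _; exists x0.
  case: eqP => [_ cl|_ /IH[x hx]]; last by exists x.
  have [x xt] := occurs_ex t; exists x; rewrite xt /=.
  rewrite add1n ltnS in cl; apply: leq_trans cl.
  by apply: sub_count => p /= /andP[].
(* A letter of a tree of maximal size is eliminated. *)
move=> h; have [a [l' [lE hl' cl']]] := elim_list x hl.
rewrite lE in h *; have [-> h'] := acts_trivially_elim h.
rewrite scale0r add0r (IHk _ l') ?lieHom0 //.
exact: leq_trans cl' cx.
Qed.

(** The Magnus-Witt embedding of free Lie algebras in free associative algebras, in
    the language of modules. *)
Theorem free_lie_faithful (P : fieldType) (V : eqType) (u : freeLie P V) :
  acts_trivially u -> u = 0.
Proof.
have [l ->] := tree_sum_surj u; set n := \max_(p <- l) tree_size p.2.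
apply: (@tree_sum_faithful _ n (size l)); last exact: count_size.
rewrite {}/n; elim: l => //= p l IH; rewrite big_cons leq_maxl /=.
by apply: sizes_le_trans IH; exact: leq_maxr.
Qed.

(** * Two-letter words that define a group law or a bilinear operation *)

Section Words.
Variable P : fieldType.

Definition bool_env (L : Type) (a b : L) : bool -> L := fun c => if c then a else b.

Definition eval_word (L : lieAlgType P) (w : freeLie P bool) (a b : L) : L :=
  free_ext (bool_env a b) w.

Lemma eval_word_hom (L L' : lieAlgType P) (h : lieHom L L') w a b :
  h (eval_word w a b) = eval_word w (h a) (h b).
Proof.
rewrite /eval_word free_ext_comp; congr (free_ext _ w).
by apply/funext => -[].
Qed.

Lemma eval_word00 (L : lieAlgType P) w : eval_word w (0 : L) 0 = 0.
Proof. by rewrite -(lieHom0 (lie_zero L L)) -eval_word_hom. Qed.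

Lemma eval_word_intertwine (M N : lmodType P) (theta : {linear M -> N})
    (A B : gl M) (A' B' : gl N) :
  (forall m, theta (A m) = A' (theta m)) -> (forall m, theta (B m) = B' (theta m)) ->
  forall w m, theta (eval_word w A B m) = eval_word w A' B' (theta m).
Proof. by move=> hA hB w; apply: intertwine => -[]. Qed.

(** Identities between words hold as soon as they hold for operators. *)
Lemma word_ext (u v : freeLie P bool) :
  (forall (M : lmodType P) (A B : gl M) e,
     eval_word u A B e = eval_word v A B e) -> u = v.
Proof.
move=> uv; apply/eqP; rewrite -subr_eq0; apply/eqP/free_lie_faithful => M rho.
rewrite lieHomD lieHomN; apply/eqP; rewrite subr_eq0; apply/eqP.
have -> : rho = bool_env (rho true) (rho false) by apply/funext => -[].
apply: glP => e; exact: uv.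
Qed.

(** On commuting elements all brackets vanish, and only the linear part of the word
    remains. *)
Lemma eval_word_commuting (w : freeLie P bool) : exists al be : P,
  forall (L : lieAlgType P) (a b : L), bracket a b = 0 ->
  eval_word w a b = al *: a + be *: b.
Proof.
elim/free_ind: w => [[]||u v [a [b uE]] [a' [b' vE]]|c u [a [b uE]]|
    u v [a [b uE]] [a' [b' vE]]].
- exists 1, 0 => L x y _; rewrite /eval_word free_ext_gen /=.
  by rewrite scale1r scale0r addr0.
- exists 0, 1 => L x y _; rewrite /eval_word free_ext_gen /=.
  by rewrite scale1r scale0r add0r.
- by exists 0, 0 => L x y _; rewrite /eval_word lieHom0 !scale0r addr0.
- exists (a + a'), (b + b') => L x y xy; rewrite /eval_word lieHomD.
  have := uE _ _ _ xy; have := vE _ _ _ xy; rewrite /eval_word => -> ->.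
  by rewrite !scalerDl addrACA.
- exists (c * a), (c * b) => L x y xy; rewrite /eval_word lieHomZ.
  by have := uE _ _ _ xy; rewrite /eval_word => ->; rewrite scalerDr !scalerA.
- exists 0, 0 => L x y xy; rewrite /eval_word lie_bracket.
  have := uE _ _ _ xy; have := vE _ _ _ xy; rewrite /eval_word => -> ->.
  rewrite bracketDl !bracketDr !bracketZl !bracketZr !bracketxx.
  by rewrite [bracket y x]bracketC xy oppr0 !scaler0 !scale0r !addr0.
Qed.

End Words.

Section Affine.
Variables (P : fieldType) (M : lmodType P).
Local Notation MP := (M * P^o)%type.
Implicit Types (A B : gl M) (m n e : M).

Lemma aff_linear A n (c : P) (p q : MP) :
  (A (c *: p + q).1 + ((c *: p + q).2 : P) *: n, 0 : P^o)
  = c *: ((A p.1 + (p.2 : P) *: n, 0) : MP) + (A q.1 + (q.2 : P) *: n, 0).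
Proof.
congr (_, _) => /=; last by rewrite scaler0 addr0.
by rewrite gl_linear scalerDl -scalerA scalerDr addrACA.
Qed.

(** The affine operator v |-> A v + n, made linear by one more coordinate. *)
Definition aff A n : gl (M * P^o)%type := Gl (aff_linear A n).

Lemma affE A n p : aff A n p = (A p.1 + (p.2 : P) *: n, 0 : P^o).
Proof. by []. Qed.

Lemma affD A B m n : aff A m + aff B n = aff (A + B) (m + n).
Proof.
apply: glP => p; rewrite gl_addE !affE; congr (_, _); last by rewrite /= addr0.
by rewrite /= addrACA scalerDr.
Qed.

Lemma affZ a A m : a *: aff A m = aff (a *: A) (a *: m).
Proof.
apply: glP => p; rewrite gl_scaleE !affE; congr (_, _); last by rewrite /= scaler0.
by rewrite /= scalerDr !scalerA mulrC.
Qed.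

Lemma affN A m : - aff A m = aff (- A) (- m).
Proof. by rewrite -[LHS]scaleN1r affZ !scaleN1r. Qed.

Lemma aff00 : aff 0 0 = 0.
Proof.
by apply: glP => p; rewrite affE gl_zeroE scaler0 addr0.
Qed.

Lemma aff_inj A B m n : aff A m = aff B n -> A = B /\ m = n.
Proof.
move=> h; split.
  apply: glP => e; have /(congr1 fst) := congr1 (fun f : gl _ => f (e, 0)) h.
  by rewrite /= !scale0r !addr0.
have /(congr1 fst) := congr1 (fun f : gl _ => f (0, 1)) h.
by rewrite /= !gl0 !scale1r !add0r.
Qed.

Lemma aff_bracket0 m n : bracket (aff 0 m) (aff 0 n) = 0.
Proof.
apply: glP => p; rewrite gl_bracketE !affE.
by apply: injective_projections; rewrite /= ?scale0r ?subrr.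
Qed.

Definition inl_fun (m : M) : MP := (m, 0).
Lemma inl_linear : linear inl_fun.
Proof. by move=> a m n; congr (_, _); rewrite /= scaler0 addr0. Qed.
HB.instance Definition _ := GRing.isLinear.Build P M MP *:%R inl_fun inl_linear.

(** M is a submodule and the additional line a trivial quotient. *)
Lemma eval_word_aff w A B m n :
  eval_word w (aff A m) (aff B n)
  = aff (eval_word w A B) (eval_word w (aff A m) (aff B n) (0, 1)).1.
Proof.
apply: glP => -[v c].
have vcE : (v, c) = inl_fun v + (c : P) *: (0, 1) :> MP.
  congr (_, _); first by rewrite /= scaler0 addr0.
  by rewrite add0r; exact: esym (mulr1 c).
rewrite [in LHS]vcE glD glZ.
rewrite -(@eval_word_intertwine _ _ _ inl_fun A B); first last.
- by move=> e; apply: injective_projections; rewrite /= ?scale0r ?addr0.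
- by move=> e; apply: injective_projections; rewrite /= ?scale0r ?addr0.
have h2 : (eval_word w (aff A m) (aff B n) (0, 1)).2 = 0.
  have := @eval_word_intertwine _ _ _ (snd : {linear MP -> P^o})
    (aff A m) (aff B n) 0 0.
  by move=> -> //; rewrite eval_word00.
by apply: injective_projections; rewrite /= ?h2 ?scaler0 ?addr0.
Qed.

(** Folding the additional line onto e intertwines the affine operators (A, A e) with
    the operators A. *)
Definition fold_fun (e : M) (p : MP) : M := p.1 + (p.2 : P) *: e.
Lemma fold_linear e : linear (fold_fun e).
Proof.
by move=> a p q; rewrite /fold_fun /= scalerDl scalerDr -scalerA addrACA.
Qed.
HB.instance Definition _ e :=
  GRing.isLinear.Build P MP M *:%R (fold_fun e) (fold_linear e).

(** The map A |-> (A, A e) is the conjugation by a translation, hence compatible with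
    words; this recovers w(A, B) e from the translation part of an affine operator. *)
Lemma eval_word_coboundary w A B e :
  eval_word w (aff A (A e)) (aff B (B e)) = aff (eval_word w A B) (eval_word w A B e).
Proof.
rewrite eval_word_aff; congr aff.
have h (C : gl M) p : fold_fun e (aff C (C e) p) = C (fold_fun e p).
  by rewrite /fold_fun /= scale0r addr0 glD glZ.
have : fold_fun e (eval_word w (aff A (A e)) (aff B (B e)) (0, 1))
     = eval_word w A B (fold_fun e (0, 1))
  := eval_word_intertwine (theta := fold_fun e) (h A) (h B) w _.
rewrite [in RHS](_ : fold_fun e (0, 1) = e); last first.
  by rewrite /fold_fun scale1r add0r.
by move=> <-; rewrite eval_word_aff affE /fold_fun /= scale0r addr0 gl0 scale1r !add0r.
Qed.

Lemma eval_word_aff_lin w A B :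
  eval_word w (aff A 0) (aff B 0) = aff (eval_word w A B) 0.
Proof. by have := eval_word_coboundary w A B 0; rewrite !gl0. Qed.

End Affine.

Section PolyAction.
Variables (P : fieldType) (M : lmodType P).
Implicit Types (A : gl M) (g : {poly P}) (n : M).

(** The value of g(A) at n. *)
Definition poly_act A n g : M := \sum_(i < size g) g`_i *: iter i A n.

Lemma poly_act_wide A n g N : (size g <= N)%N ->
  poly_act A n g = \sum_(i < N) g`_i *: iter i A n.
Proof.
move=> gN; rewrite /poly_act (big_ord_widen _ (fun i => g`_i *: iter i A n) gN).
rewrite big_mkcond; apply: eq_bigr => i _; case: ltnP => // /(nth_default 0) ->.
by rewrite scale0r.
Qed.

Lemma poly_act_linear A n : linear (poly_act A n).
Proof.
move=> a g h; set N := maxn (size g) (size h).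
rewrite (@poly_act_wide _ _ g N) ?leq_maxl // (@poly_act_wide _ _ h N) ?leq_maxr //.
rewrite (@poly_act_wide _ _ _ N); last first.
  rewrite (leq_trans (size_polyD _ _)) // geq_max leq_maxr andbT.
  by rewrite (leq_trans (size_scale_leq _ _)) // leq_maxl.
rewrite scaler_sumr -big_split; apply: eq_bigr => i _ /=.
by rewrite coefD coefZ scalerDl scalerA.
Qed.
HB.instance Definition _ A n :=
  GRing.isLinear.Build P {poly P} M *:%R (poly_act A n) (poly_act_linear A n).

Lemma poly_actC A n a : poly_act A n a%:P = a *: n.
Proof.
by rewrite (@poly_act_wide _ _ _ 1) ?size_polyC_leq1 // big_ord1 coefC.
Qed.

Lemma poly_actDr A m n g : poly_act A (m + n) g = poly_act A m g + poly_act A n g.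
Proof.
rewrite /poly_act -big_split; apply: eq_bigr => i _ /=; rewrite -scalerDr.
by congr (_ *: _); elim: (i : nat) => //= j ->; rewrite glD.
Qed.

Lemma poly_actXM A n g : poly_act A n ('X * g) = A (poly_act A n g).
Proof.
rewrite (@poly_act_wide _ _ _ (size g).+1); last first.
  by rewrite (leq_trans (size_polyMleq _ _)) // size_polyX.
rewrite big_ord_recl coefXM scale0r add0r /poly_act.
elim/big_rec2: _ => [|i x y _ ->]; first by rewrite gl0.
by rewrite glD glZ coefXM.
Qed.

Definition mulX_gl : gl {poly P}.
Proof.
by exists (fun g => 'X * g) => a g h; rewrite mulrDr scalerAr.
Defined.

Definition poly_pair A n (p : ({poly P} * P^o)%type) : (M * P^o)%type :=
  (poly_act A n p.1, p.2).

Lemma poly_pair_linear A n : linear (poly_pair A n).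
Proof. by move=> a p q; congr (_, _); rewrite /= linearP. Qed.
HB.instance Definition _ A n :=
  GRing.isLinear.Build P _ _ *:%R (poly_pair A n) (poly_pair_linear A n).

End PolyAction.

Lemma poly_act_mulX (P : fieldType) (g n : {poly P}) : poly_act (mulX_gl P) n g = g * n.
Proof.
rewrite -[g in RHS]coefK poly_def mulr_suml; apply: eq_bigr => i _.
rewrite -scalerAl; congr (_ *: _); elim: (i : nat) => [|k IH].
  by rewrite expr0 mul1r.
by rewrite /= IH exprS mulrA.
Qed.

(** P[t] with t acting by multiplication, and its element 1, is universal among
    modules with an operator A and a vector n. *)
Lemma eval_word_aff_poly (P : fieldType) (w : freeLie P bool) : exists f : {poly P},
  forall (M : lmodType P) (A : gl M) n,
  eval_word w (aff A 0) (aff 0 n) = aff (eval_word w A 0) (poly_act A n f).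
Proof.
exists (eval_word w (aff (mulX_gl P) 0) (aff 0 1) (0, 1)).1 => M A n.
rewrite eval_word_aff; congr aff.
have e01 : (0, 1) = poly_pair A n (0, 1).
  by apply: injective_projections => //=; rewrite linear0.
have h1 p : poly_pair A n (aff (mulX_gl P) 0 p) = aff A 0 (poly_pair A n p).
  by apply: injective_projections => //=; rewrite !scaler0 !addr0 poly_actXM.
have h2 p : poly_pair A n (aff 0 1 p) = aff 0 n (poly_pair A n p).
  apply: injective_projections => //=.
  by rewrite !add0r linearZ /= -[1]/(1%:P) poly_actC scale1r.
rewrite [in LHS]e01.
by rewrite -(eval_word_intertwine (theta := poly_pair A n) h1 h2).
Qed.

Section GroupWord.
Variables (P : fieldType) (w : freeLie P bool) (eps : P).
Hypothesis w0 : forall (L : lieAlgType P) (a : L), eval_word w a 0 = a.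
Hypothesis wC : forall (L : lieAlgType P) (a b : L), eval_word w a b = eval_word w b a.
Hypothesis wA : forall (L : lieAlgType P) (a b c : L),
  eval_word w a (eval_word w b c) = eval_word w (eval_word w a b) c.
Hypothesis wN : forall (L : lieAlgType P) (a : L), eval_word w (eps *: a) a = 0.

(** On P[t], subtracting (X, 0) from (X, 1) for the group law leaves some (0, n), and
    adding (X, 0) back gives f n = 1 for the polynomial f of the word; so f is a
    unit of P[t]. *)
Lemma group_word_poly : exists c : P,
  forall (M : lmodType P) (A : gl M) n,
    eval_word w (aff A 0) (aff 0 n) = aff A (c *: n).
Proof.
have [f fE] := eval_word_aff_poly w.
pose X := mulX_gl P.
pose v := eval_word w (aff (eps *: X) 0) (aff X 1).
have vE : v = aff 0 (v (0, 1)).1 by rewrite {1}/v eval_word_aff wN.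
have : eval_word w (aff X 0) v = aff X 1.
  rewrite wA [eval_word w (aff X 0) _]wC -[in aff (_ *: _) 0](scaler0 _ eps) -affZ wN.
  by rewrite wC w0.
rewrite vE fE w0 => /aff_inj[_]; rewrite poly_act_mulX => f1.
have : f \is a GRing.unit by apply/unitrP; exists (v (0, 1)).1; rewrite mulrC f1.
rewrite poly_unitE => /andP[/size_poly1P[c _ fc] _].
by exists c => M A n; rewrite fE w0 fc poly_actC.
Qed.

Lemma group_word_unit (M : lmodType P) (A : gl M) n :
  eval_word w (aff A 0) (aff 0 n) = aff A n.
Proof.
have [c cE] := group_word_poly; rewrite cE.
suff -> : c = 1 by rewrite scale1r.
have := cE P^o 0 1; rewrite aff00 wC w0 => /aff_inj[_] /esym.
by rewrite -[LHS]/(c * 1) mulr1.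
Qed.

Lemma group_word_abelian (M : lmodType P) (m n : M) :
  eval_word w (aff 0 m) (aff 0 n) = aff 0 (m + n).
Proof.
have [al [be abE]] := eval_word_commuting w.
have al1 : al = 1.
  have := w0 (aff 0 (1 : P^o)); rewrite abE ?bracket0r // scaler0 addr0 affZ.
  by move=> /aff_inj[_]; rewrite -[LHS]/(al * 1) mulr1.
have be1 : be = 1.
  have := w0 (aff 0 (1 : P^o)); rewrite wC abE ?bracket0l // scaler0 add0r affZ.
  by move=> /aff_inj[_]; rewrite -[LHS]/(be * 1) mulr1.
by rewrite abE ?aff_bracket0 // al1 be1 !scale1r affD addr0.
Qed.

(** Splitting (A, A e) = (A, 0) + (0, A e) for the group law and interchanging terms
    shows that translation parts add up. *)
Theorem group_word_add : w = gen P true + gen P false.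
Proof.
apply: word_ext => M A B e.
rewrite [in RHS]/eval_word lieHomD !free_ext_gen gl_addE /=.
suff : aff (eval_word w A B) (eval_word w A B e)
       = aff (eval_word w A B) (A e + B e) by case/aff_inj.
rewrite -eval_word_coboundary -[in LHS](group_word_unit A) -[in LHS](group_word_unit B).
rewrite -wA [eval_word w (aff 0 _) _]wC -[eval_word w (eval_word w (aff B _) _) _]wA.
rewrite group_word_abelian wA eval_word_aff_lin group_word_unit.
by rewrite [B e + _]addrC.
Qed.

End GroupWord.

Section BilinearWord.
Variables (P : fieldType) (w : freeLie P bool).
Hypothesis wDl : forall (L : lieAlgType P) (a b c : L),
  eval_word w (a + b) c = eval_word w a c + eval_word w b c.
Hypothesis wDr : forall (L : lieAlgType P) (a b c : L),
  eval_word w a (b + c) = eval_word w a b + eval_word w a c.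
Hypothesis wxx : forall (L : lieAlgType P) (a : L), eval_word w a a = 0.

Lemma bilinear_word0r (L : lieAlgType P) (a : L) : eval_word w a 0 = 0.
Proof. by apply: (addrI (eval_word w a 0)); rewrite -wDr !addr0. Qed.

Lemma bilinear_word0l (L : lieAlgType P) (a : L) : eval_word w 0 a = 0.
Proof. by apply: (addrI (eval_word w 0 a)); rewrite -wDl !addr0. Qed.

Lemma bilinear_wordC (L : lieAlgType P) (a b : L) : eval_word w a b = - eval_word w b a.
Proof.
apply/eqP; rewrite -addr_eq0; apply/eqP.
by have := wxx (a + b); rewrite wDl !wDr !wxx add0r addr0.
Qed.

Lemma bilinear_word_abelian (M : lmodType P) (m n : M) :
  eval_word w (aff 0 m) (aff 0 n) = 0.
Proof.
have [al [be abE]] := eval_word_commuting w.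
have al0 : al = 0.
  have := bilinear_word0r (aff 0 (1 : P^o)).
  rewrite abE ?bracket0r // scaler0 addr0 affZ -aff00.
  by move=> /aff_inj[_]; rewrite -[LHS]/(al * 1) mulr1.
have be0 : be = 0.
  have := bilinear_word0l (aff 0 (1 : P^o)).
  rewrite abE ?bracket0l // scaler0 add0r affZ -aff00.
  by move=> /aff_inj[_]; rewrite -[LHS]/(be * 1) mulr1.
by rewrite abE ?aff_bracket0 // al0 be0 !scale0r addr0.
Qed.

(** The affine operators (A, A e) and (B, B e) are split into linear and translation
    parts; by additivity only the mixed terms contribute to the translation part. *)
Lemma bilinear_word_poly : exists g : {poly P},
  forall (M : lmodType P) (A B : gl M) e,
  eval_word w A B e = poly_act A (B e) g - poly_act B (A e) g.
Proof.
have [g gE] := eval_word_aff_poly w; exists g => M A B e.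
suff : aff (eval_word w A B) (eval_word w A B e)
       = aff (eval_word w A B) (poly_act A (B e) g - poly_act B (A e) g).
  by case/aff_inj.
rewrite -eval_word_coboundary.
have affS (C : gl M) m : aff C m = aff C 0 + aff 0 m by rewrite affD addr0 add0r.
rewrite (affS A) (affS B) wDl !wDr bilinear_word_abelian eval_word_aff_lin gE.
rewrite [eval_word w (aff 0 _) _]bilinear_wordC !gE !bilinear_word0r addr0 affN.
by rewrite !affD oppr0 !addr0 add0r.
Qed.

(** Multiplication by t on P[t] is the sum of this operator and of another one with
    which it does not commute; only the first power of the sum is the sum of the
    powers at 1. *)
Definition drop_fun (g : {poly P}) : {poly P} := g`_0 *: 'X.

Lemma drop_linear a (g h : {poly P}) :
  drop_fun (a *: g + h) = a *: drop_fun g + drop_fun h.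
Proof. by rewrite /drop_fun coefD coefZ scalerDl scalerA. Qed.

Definition drop_gl : gl {poly P} := Gl drop_linear.

Lemma poly_act_trunc (M : lmodType P) (A : gl M) n (g : {poly P}) k :
  iter k A n = 0 -> poly_act A n g = \sum_(i < k) g`_i *: iter i A n.
Proof.
move=> An; rewrite (@poly_act_wide _ _ _ _ _ (k + size g)) ?leq_addl //.
rewrite big_split_ord /= [X in _ + X]big1 ?addr0 // => i _.
suff -> : iter (k + i) A n = 0 by rewrite scaler0.
by rewrite addnC iterD An; elim: (i : nat) => //= j ->; rewrite gl0.
Qed.

(** Taking B = 1 in the formula of [bilinear_word_poly] shows that g is additive on
    operators; on P[t] the sum of the operators A and A' below is multiplication by
    t, while their iterates at 1 vanish from the first or the second one on. *)
Theorem bilinear_word_bracket : exists c, w = c *: bracket (gen P true) (gen P false).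
Proof.
have [g gE] := bilinear_word_poly.
have gD (M : lmodType P) (A B : gl M) e :
    poly_act (A + B) e g = poly_act A e g + poly_act B e g.
  have h := congr1 (fun f : gl M => f e) (wDl A B (gl_scalar M 1)).
  have id1 n : gl_scalar M 1 n = n by exact: scale1r.
  by move: h; rewrite gl_addE !gE !id1 gl_addE poly_actDr addrACA -opprD => /addIr.
have X1 : poly_act (mulX_gl P) 1 g = g by rewrite poly_act_mulX mulr1.
pose A' := drop_gl; pose A := mulX_gl P - A'.
have A1 : A 1 = 0.
  by rewrite /A gl_addE /= /drop_fun mulr1 coef1 scale1r subrr.
have A'1 : drop_fun 1 = 'X by rewrite /drop_fun coef1 scale1r.
have A'X : drop_fun 'X = 0 by rewrite /drop_fun coefX scale0r.
have gX : g = g`_1 *: 'X.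
  have : g = g`_0 *: 1 + (g`_0 *: 1 + g`_1 *: 'X).
    rewrite -[LHS]X1 -[mulX_gl P](subrK A') gD; congr (_ + _).
      by rewrite (@poly_act_trunc _ _ _ _ 1) // big_ord1.
    rewrite (@poly_act_trunc _ _ _ _ 2) ?big_ord_recl ?big_ord0 ?addr0 /=.
      by rewrite A'1.
    by rewrite A'1 A'X.
  move=> gE'; have g0 : g`_0 = 0.
    have := congr1 (fun h : {poly P} => h`_0) gE'.
    rewrite !coefD !coefZ coef1 coefX mulr0 addr0 mulr1 => h.
    by apply: (addrI g`_0); rewrite -h addr0.
  by rewrite {1}gE' g0 !scale0r !add0r.
move: gX; set c := g`_1 => gX; exists c; apply: word_ext => M B C e.
rewrite gE gX !linearZ /= -['X]mulr1 !poly_actXM -[1]/(1%:P) !poly_actC.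
rewrite !scale1r -scalerDr.
rewrite [in RHS]/eval_word lieHomZ lie_bracket !free_ext_gen.
by rewrite gl_scaleE gl_bracketE.
Qed.

End BilinearWord.

(** * Autoequivalences of the category of free Lie algebras *)

Definition faithful (C D : category) (F : functor C D) : Prop :=
  forall (a b : C) (f g : hom a b), fhom F f = fhom F g -> f = g.

Definition full (C D : category) (F : functor C D) : Prop :=
  forall (a b : C) (h : hom (F a) (F b)), exists f, fhom F f = h.

Definition ess_surj (C D : category) (F : functor C D) : Prop :=
  forall d : D, exists (a : C) (u : hom (F a) d) (v : hom d (F a)),
    cmp v u = idm (F a) /\ cmp u v = idm d.

Section Generators.
Variables (P : fieldType) (V : eqType).

Lemma gen_inj : injective (@gen P V).
Proof.
move=> x y xy; apply/eqP; case: eqP => // nxy.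
pose f (z : V) : gl P^o := gl_scalar _ (z == x)%:R.
have := congr1 (fun u => free_ext f u 1) xy; rewrite !free_ext_gen.
rewrite /f eqxx eq_sym (introF eqP nxy).
move=> /eqP; rewrite -[X in X == _]/(1 * 1) -[X in _ == X]/(0 * 1).
by rewrite mul0r mul1r oner_eq0.
Qed.

Lemma gen_neq0 (x : V) : gen P x <> 0.
Proof.
move=> x0; have := congr1 (fun u => free_ext (fun=> gl_scalar P^o 1) u 1) x0.
rewrite free_ext_gen lieHom0 -[RHS]/0 -[LHS]/(1 * 1) mul1r => /eqP.
by rewrite oner_eq0.
Qed.

Lemma free_rank1 (x : V) (u : freeLie P V) : (forall y, y = x) ->
  exists a, u = a *: gen P x.
Proof.
move=> Vx; elim/free_ind: u => [y||u v [a ->] [b ->]|c u [a ->]|u v [a ->] [b ->]].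
- by exists 1; rewrite (Vx y) scale1r.
- by exists 0; rewrite scale0r.
- by exists (a + b); rewrite scalerDl.
- by exists (c * a); rewrite scalerA.
- by exists 0; rewrite bracketZl bracketZr bracketxx !scaler0 scale0r.
Qed.

End Generators.

Section SemiInner.
Variables (P : fieldType) (X0 : choiceType).
Hypothesis X0_infinite : infinite_set [set: X0].
Variable phi : functor (Theta0 P X0) (Theta0 P X0).
Hypotheses (phi_faithful : faithful phi) (phi_full : full phi)
  (phi_ess_surj : ess_surj phi).

Local Notation W X := (freeLie P (fset_sub_type X)).

Definition phi_hom (X Y : {fset X0}) (f : lieHom (W X) (W Y)) :
  lieHom (W (phi X : {fset X0})) (W (phi Y : {fset X0})) := @fhom _ _ phi X Y f.

Lemma phi_hom1 X : phi_hom (lie_id (W X)) = lie_id _.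
Proof. exact: (fhom1 phi X). Qed.

Lemma phi_homM X Y Z (g : lieHom (W Y) (W Z)) (f : lieHom (W X) (W Y)) u :
  phi_hom (lie_comp g f) u = phi_hom g (phi_hom f u).
Proof.
exact: (congr1 (fun h : lieHom _ _ => h u) (@fhomM _ _ phi X Y Z g f)).
Qed.

Variable x0 : X0.
Local Notation X1 := [fset x0]%fset.
Local Notation Z1 := (phi X1 : {fset X0}).

Definition base : X1 := [` fset11 x0]%fset.

Lemma base_uniq (x : X1) : x = base.
Proof. by apply: val_inj => /=; have := valP x; rewrite in_fset1 => /eqP. Qed.

(** Endomorphisms of W(x0) are scalars, so those of its image commute. With two letters
    z and z', the substitutions of z and of z' for all letters do not commute; without
    letters there is only one endomorphism. *)
Lemma rank1_image : exists z0 : Z1, forall z, z = z0.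
Proof.
have [[z0 _]|noz] := pselect (exists z0 : Z1, True); last first.
  suff : gen P base = 0 by move/gen_neq0.
  have : phi_hom (lie_id (W X1)) = phi_hom (lie_zero _ _).
    by apply: free_hom_ext => z; case: noz; exists z.
  by move=> /phi_faithful /(congr1 (fun h : lieHom _ _ => h (gen P base))).
exists z0 => z.
pose f : lieHom (W Z1) (W Z1) := free_ext (fun=> gen P z).
pose g : lieHom (W Z1) (W Z1) := free_ext (fun=> gen P z0).
have [f' ff'] := phi_full (f : @hom (Theta0 P X0) (phi X1) (phi X1)).
have [g' gg'] := phi_full (g : @hom (Theta0 P X0) (phi X1) (phi X1)).
have fg : lie_comp f' g' = lie_comp g' f'.
  apply: free_hom_ext => x; rewrite (base_uniq x) !lie_compE.
  have [a aE] := free_rank1 (g' (gen P base)) base_uniq.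
  have [b bE] := free_rank1 (f' (gen P base)) base_uniq.
  by rewrite aE bE !lieHomZ aE bE !scalerA mulrC.
have : f (g (gen P z0)) = g (f (gen P z0)).
  by rewrite -ff' -gg' -[LHS]phi_homM -[RHS]phi_homM fg.
by rewrite /f /g !free_ext_gen => /gen_inj.
Qed.

Definition z0 : Z1 := projT1 (cid rank1_image).

Lemma z0_uniq z : z = z0.
Proof. exact: (projT2 (cid rank1_image)). Qed.

Definition point (X : {fset X0}) (a : W X) : lieHom (W X1) (W X) := free_ext (fun=> a).

Lemma pointE X (a : W X) : point a (gen P base) = a.
Proof. exact: free_ext_gen. Qed.

Lemma point_hom X (f : lieHom (W X1) (W X)) : point (f (gen P base)) = f.
Proof. by apply: free_hom_ext => x; rewrite (base_uniq x) pointE. Qed.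

Lemma point_comp X Y (f : lieHom (W X) (W Y)) a : lie_comp f (point a) = point (f a).
Proof. by rewrite -[LHS]point_hom lie_compE pointE. Qed.

(** Elements are homomorphisms from the free algebra of rank one, to which the
    functor applies. *)
Definition image_elt X (a : W X) : W (phi X) := phi_hom (point a) (gen P z0).

Lemma image_elt_nat X Y (f : lieHom (W X) (W Y)) a :
  phi_hom f (image_elt a) = image_elt (f a).
Proof. by rewrite /image_elt -phi_homM point_comp. Qed.

Lemma image_elt_inj X : injective (@image_elt X).
Proof.
move=> a b ab; have : phi_hom (point a) = phi_hom (point b).
  by apply: free_hom_ext => z; rewrite (z0_uniq z).
move=> /phi_faithful /(congr1 (fun h : lieHom _ _ => h (gen P base))).
by rewrite !pointE.
Qed.

Lemma image_elt_surj X (u : W (phi X)) : exists a : W X, image_elt a = u.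
Proof.
have [f fE] := phi_full (free_ext (fun=> u) : @hom (Theta0 P X0) (phi X1) (phi X)).
exists (f (gen P base)); rewrite /image_elt point_hom /phi_hom fE.
exact: free_ext_gen.
Qed.

Lemma image_elt_base : image_elt (gen P base) = gen P z0.
Proof.
rewrite /image_elt (_ : point _ = lie_id _) ?phi_hom1 //.
by rewrite -[RHS]point_hom.
Qed.

Lemma scalar_image (l : P) : exists k, image_elt (l *: gen P base) = k *: gen P z0.
Proof. exact/free_rank1/z0_uniq. Qed.

Definition sigma (l : P) : P := projT1 (cid (scalar_image l)).

Lemma sigmaE l : image_elt (l *: gen P base) = sigma l *: gen P z0.
Proof. exact: (projT2 (cid (scalar_image l))). Qed.

Lemma image_elt_scale X l (a : W X) : image_elt (l *: a) = sigma l *: image_elt a.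
Proof.
by rewrite -{1}[a]pointE -lieHomZ -image_elt_nat sigmaE lieHomZ.
Qed.

Lemma gen_scale_inj (V : eqType) (x : V) (k l : P) :
  k *: gen P x = l *: gen P x -> k = l.
Proof.
move=> /eqP; rewrite -subr_eq0 -scalerBl => /eqP kl; apply/eqP; rewrite -subr_eq0.
apply/negP => /negP d0; case: (@gen_neq0 P V x).
by rewrite -[LHS]scale1r -(mulVf d0) -scalerA kl scaler0.
Qed.

Lemma sigmaM l m : sigma (l * m) = sigma l * sigma m.
Proof.
apply: (gen_scale_inj (x := z0)).
by rewrite -[RHS]scalerA -!sigmaE -image_elt_scale scalerA.
Qed.

Lemma sigma1 : sigma 1 = 1.
Proof.
by apply: (gen_scale_inj (x := z0)); rewrite -sigmaE !scale1r image_elt_base.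
Qed.

Lemma sigma_inj : injective sigma.
Proof.
move=> l m lm; apply: (gen_scale_inj (x := base)).
by apply: image_elt_inj; rewrite !sigmaE lm.
Qed.

Lemma sigma_surj k : exists l, sigma l = k.
Proof.
have [a aE] := image_elt_surj (X := X1) (k *: gen P z0).
have [l lE] := free_rank1 a base_uniq.
by exists l; apply: (gen_scale_inj (x := z0)); rewrite -sigmaE -lE.
Qed.

Lemma image_elt0 X : image_elt (0 : W X) = 0.
Proof.
have [l l0] := sigma_surj 0; have : sigma 0 = 0.
  by have := sigmaM 0 l; rewrite mul0r l0 mulr0.
by move=> s0; rewrite -[0 in LHS](scale0r 0) image_elt_scale s0 scale0r.
Qed.

(** Every assignment of values in L to finitely many letters is the image of
    elements of the form [image_elt a], because every W(Z) is isomorphic to some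
    W(phi X). Hence word identities between such elements are
    identities of all Lie algebras. *)
Lemma lift_env (Z : {fset X0}) (L : lieAlgType P) (env : Z -> L) :
  exists (X : {fset X0}) (theta : lieHom (W (phi X)) L) (a : Z -> W X),
  forall z, theta (image_elt (a z)) = env z.
Proof.
have [X [u [v [_ uv]]]] := phi_ess_surj Z.
have /choice[a aE] : forall z : Z,
    exists a : W X, image_elt a = (v : lieHom _ _) (gen P z).
  by move=> z; exact: image_elt_surj.
exists X, (lie_comp (free_ext env) u), a => z; rewrite aE lie_compE.
have := congr1 (fun h : lieHom _ _ => h (gen P z)) uv.
by rewrite /= => ->; rewrite free_ext_gen.
Qed.

Lemma three_letters : exists x y z : X0, [/\ x != y, x != z & y != z].
Proof.
have [B _ B3] := infinite_set_fset 3 X0_infinite.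
have : uniq (enum_fset B) := fset_uniq B.
move: B3; case: (enum_fset B) => [|x [|y [|z l]]] // _ /=.
rewrite !inE !negb_or => /andP[/and3P[xy xz _] /andP[/andP[yz _] _]].
by exists x, y, z.
Qed.

Lemma lift3 (L : lieAlgType P) (a b c : L) :
  exists (X : {fset X0}) (theta : lieHom (W (phi X)) L) (a' b' c' : W X),
  [/\ theta (image_elt a') = a, theta (image_elt b') = b & theta (image_elt c') = c].
Proof.
have [x [y [z [xy xz yz]]]] := three_letters.
pose Z := [fset x; y; z]%fset.
pose env (t : Z) := if val t == x then a else if val t == y then b else c.
have [X [theta [e eE]]] := lift_env env.
have xZ : x \in Z by rewrite !inE eqxx.
have yZ : y \in Z by rewrite !inE eqxx orbT.
have zZ : z \in Z by rewrite !inE eqxx !orbT.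
exists X, theta, (e [` xZ]%fset), (e [` yZ]%fset), (e [` zZ]%fset).
rewrite !eE /env /= !eqxx; split=> //; first by rewrite eq_sym (negbTE xy).
by rewrite eq_sym (negbTE xz) eq_sym (negbTE yz).
Qed.

Section Derived.
Variables (x y : X0) (xy : x != y).
Local Notation D := [fset x; y]%fset.

Definition letter1 : D := [` fset21 x y]%fset.
Definition letter2 : D := [` fset22 x y]%fset.

Definition pair_hom (L : lieAlgType P) (a b : L) : lieHom (W D) L :=
  free_ext (fun z : D => if val z == x then a else b).

Lemma pair_hom1 (L : lieAlgType P) (a b : L) : pair_hom a b (gen P letter1) = a.
Proof. by rewrite /pair_hom free_ext_gen /= eqxx. Qed.

Lemma pair_hom2 (L : lieAlgType P) (a b : L) : pair_hom a b (gen P letter2) = b.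
Proof. by rewrite /pair_hom free_ext_gen /= eq_sym (negbTE xy). Qed.

Lemma pair_hom_ext (L : lieAlgType P) (f g : lieHom (W D) L) :
  f (gen P letter1) = g (gen P letter1) -> f (gen P letter2) = g (gen P letter2) ->
  f = g.
Proof.
move=> h1 h2; apply: free_hom_ext => z.
have := valP z; rewrite !inE => /orP[] /eqP zE.
  by rewrite (_ : z = letter1) //; apply: val_inj.
by rewrite (_ : z = letter2) //; apply: val_inj.
Qed.

(** The images of the two letters generate the image of W(x, y). By essential
    surjectivity W(x, y) is isomorphic to some W(phi X), and the images of the letters
    can be sent to the letters there; the composite e back to the image of W(x, y)
    comes from an endomorphism of W(x, y) fixing both letters. *)
Lemma pair_image (u : W (phi D)) : exists w : freeLie P bool,
  u = eval_word w (image_elt (gen P letter1)) (image_elt (gen P letter2)).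
Proof.
have [X [al [be [_ albe]]]] := phi_ess_surj D.
have [a aE] := image_elt_surj ((be : lieHom _ _) (gen P letter1)).
have [b bE] := image_elt_surj ((be : lieHom _ _) (gen P letter2)).
pose g : lieHom (W (phi D)) (W D) := lie_comp al (phi_hom (pair_hom a b)).
have abe z : (al : lieHom _ _) ((be : lieHom _ _) z) = z.
  exact: (congr1 (fun h : lieHom _ _ => h z) albe).
have g1 : g (image_elt (gen P letter1)) = gen P letter1.
  by rewrite /g lie_compE image_elt_nat pair_hom1 aE abe.
have g2 : g (image_elt (gen P letter2)) = gen P letter2.
  by rewrite /g lie_compE image_elt_nat pair_hom2 bE abe.
pose j : lieHom (W D) (W (phi D)) :=
  pair_hom (image_elt (gen P letter1)) (image_elt (gen P letter2)).
have [e eE] := phi_full (lie_comp j g : @hom (Theta0 P X0) (phi D) (phi D)).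
have e1 : e = lie_id (W D).
  apply: pair_hom_ext; apply: image_elt_inj;
    rewrite -image_elt_nat /phi_hom eE lie_compE.
    by rewrite g1 /j pair_hom1.
  by rewrite g2 /j pair_hom2.
have jg : j (g u) = u.
  by rewrite -lie_compE -eE e1 -/(phi_hom _) phi_hom1.
exists (pair_hom (gen P true) (gen P false) (g u)).
rewrite /eval_word -lie_compE -[LHS]jg; congr (lie_fun _ (g u)).
by apply: pair_hom_ext; rewrite lie_compE ?pair_hom1 ?pair_hom2 free_ext_gen /j
  ?pair_hom1 ?pair_hom2.
Qed.

(** Every binary operation of the free algebras is carried by the functor to an
    operation given by a single word. *)
Lemma derived_word (t : W D) : exists w : freeLie P bool,
  forall (X : {fset X0}) (a b : W X),
    image_elt (pair_hom a b t) = eval_word w (image_elt a) (image_elt b).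
Proof.
have [w wE] := pair_image (image_elt t); exists w => X a b.
by rewrite -image_elt_nat wE eval_word_hom !image_elt_nat pair_hom1 pair_hom2.
Qed.

End Derived.

Lemma image_eltD X (a b : W X) : image_elt (a + b) = image_elt a + image_elt b.
Proof.
have [x [y [_ [xy _ _]]]] := three_letters.
have [w wE] := derived_word xy (gen P (letter1 x y) + gen P (letter2 x y)).
have wD Y (c d : W Y) : image_elt (c + d) = eval_word w (image_elt c) (image_elt d).
  by rewrite -wE lieHomD pair_hom1 pair_hom2.
suff wE' : w = gen P true + gen P false.
  by rewrite wD wE' /eval_word lieHomD !free_ext_gen.
(* The inverse for the transported addition is the scalar sigma (- 1). *)
apply: (@group_word_add P w (sigma (- 1))) => [L c|L c d|L c d e|L c].
- have [Y [theta [c' [_ [_ [<- _ _]]]]]] := lift3 c 0 0.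
  by rewrite -(lieHom0 theta) -(image_elt0 Y) -eval_word_hom -wD addr0.
- have [Y [theta [c' [d' [_ [<- <- _]]]]]] := lift3 c d 0.
  by rewrite -!eval_word_hom -!wD addrC.
- have [Y [theta [c' [d' [e' [<- <- <-]]]]]] := lift3 c d e.
  by rewrite -!eval_word_hom -!wD addrA.
- have [Y [theta [c' [_ [_ [<- _ _]]]]]] := lift3 c 0 0.
  rewrite -lieHomZ -image_elt_scale -eval_word_hom -wD scaleN1r addNr.
  by rewrite image_elt0 lieHom0.
Qed.

Lemma image_elt_bracket : exists c, forall X (a b : W X),
  image_elt (bracket a b) = c *: bracket (image_elt a) (image_elt b).
Proof.
have [x [y [_ [xy _ _]]]] := three_letters.
have [w wE] := derived_word xy (bracket (gen P (letter1 x y)) (gen P (letter2 x y))).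
have wB Y (c d : W Y) :
    image_elt (bracket c d) = eval_word w (image_elt c) (image_elt d).
  by rewrite -wE lie_bracket pair_hom1 pair_hom2.
suff [c wE'] : exists c, w = c *: bracket (gen P true) (gen P false).
  exists c => X a b.
  by rewrite wB wE' /eval_word lieHomZ lie_bracket !free_ext_gen.
apply: bilinear_word_bracket => [L c d e|L c d e|L c].
- have [Y [theta [c' [d' [e' [<- <- <-]]]]]] := lift3 c d e.
  by rewrite -lieHomD -image_eltD -!eval_word_hom -!wB bracketDl image_eltD lieHomD.
- have [Y [theta [c' [d' [e' [<- <- <-]]]]]] := lift3 c d e.
  by rewrite -lieHomD -image_eltD -!eval_word_hom -!wB bracketDr image_eltD lieHomD.
- have [Y [theta [c' [_ [_ [<- _ _]]]]]] := lift3 c 0 0.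
  by rewrite -eval_word_hom -wB bracketxx image_elt0 lieHom0.
Qed.

(** Hence the scalar c of [image_elt_bracket] is not zero. *)
Lemma free_nonabelian (x y : X0) : x != y ->
  bracket (gen P (letter1 x y)) (gen P (letter2 x y)) <> 0.
Proof.
move=> xy /(congr1 (@pair_hom x y (gl {poly P}) (mulX_gl P) (drop_gl P))).
rewrite lie_bracket lieHom0 pair_hom1 pair_hom2 //.
move=> /(congr1 (fun f : gl {poly P} => (f 1)`_2)).
rewrite gl_bracketE /= /drop_fun coef1 mulr1 coefX scale1r scale0r subr0 coef0.
by rewrite -expr2 coefXn => /eqP; rewrite oner_eq0.
Qed.

Lemma sigmaD l m : sigma (l + m) = sigma l + sigma m.
Proof.
apply: (gen_scale_inj (x := z0)).
by rewrite -sigmaE scalerDl image_eltD !sigmaE scalerDl.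
Qed.

End SemiInner.

Lemma field_bijection_aut (P : fieldType) (f : P -> P) :
  (forall a b, f (a + b) = f a + f b) -> (forall a b, f (a * b) = f a * f b) ->
  f 1 = 1 -> injective f -> (forall b, exists a, f a = b) ->
  exists s : fieldAut P, s =1 f.
Proof.
move=> fD fM f1 finj /choice[g fg].
have gf : cancel f g by move=> a; apply: finj; rewrite fg.
have fB : zmod_morphism f.
  by move=> a b; apply: (addIr (f b)); rewrite -fD !subrK.
have fm : monoid_morphism f by split.
have gB : zmod_morphism g.
  by move=> a b; apply: finj; rewrite fB !fg.
have gm : monoid_morphism g.
  by split=> [|a b]; apply: finj; rewrite ?fM ?fg ?f1.
pose fz := GRing.isZmodMorphism.Build P P f fB.
pose fr := GRing.isMonoidMorphism.Build P P f fm.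
pose gz := GRing.isZmodMorphism.Build P P g gB.
pose gr := GRing.isMonoidMorphism.Build P P g gm.
pose F : {rmorphism P -> P} := HB.pack f fz fr.
pose G : {rmorphism P -> P} := HB.pack g gz gr.
by exists (@FieldAut P F G gf fg).
Qed.

Definition aut_V (P : fieldType) (s : fieldAut P) : fieldAut P :=
  FieldAut (aut_invK s) (aut_funK s).

Record lie_semilinear (P : fieldType) (s : fieldAut P) (A B : lieAlgType P)
    (f : A -> B) : Prop := Semilinear {
  semi_linear : forall a x y, f (a *: x + y) = s a *: f x + f y;
  semi_bracket : forall x y, f (bracket x y) = bracket (f x) (f y) }.

Section SemilinearTheory.
Variables (P : fieldType) (s : fieldAut P) (A B : lieAlgType P) (f : A -> B).
Hypothesis hf : lie_semilinear s f.

Lemma semi0 : f 0 = 0.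
Proof.
apply: (addrI (f 0)); rewrite addr0 -{2}[f 0]scale1r -(rmorph1 s).
by rewrite addrC -(semi_linear hf) scaler0 addr0.
Qed.

Lemma semiZ a x : f (a *: x) = s a *: f x.
Proof. by have := semi_linear hf a x 0; rewrite semi0 !addr0. Qed.

Lemma semi_comp (C : lieAlgType P) (g : lieHom B C) :
  lie_semilinear s (g \o f).
Proof.
split=> [a x y|x y] /=; first by rewrite (semi_linear hf) lie_linear.
by rewrite (semi_bracket hf) lie_bracket.
Qed.

End SemilinearTheory.

(** The bijections [image_elt] are multiplied by the scalar c of
    [image_elt_bracket], which makes them compatible with brackets: if
    s[a, b] = c [s a, s b] then c s[a, b] = [c s a, c s b]. *)
Theorem autoequivalence_semi_inner (P : fieldType) (X0 : choiceType)
    (phi : functor (Theta0 P X0) (Theta0 P X0)) :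
  infinite_set [set: X0] -> faithful phi -> full phi -> ess_surj phi ->
  exists (s : fieldAut P)
    (tau : forall X : {fset X0}, freeLie P X -> freeLie P (phi X : {fset X0})),
  [/\ forall X, lie_semilinear s (tau X),
      forall X, injective (tau X),
      forall X u, exists a, tau X a = u &
      forall (X Y : {fset X0}) (f : lieHom (freeLie P X) (freeLie P Y)) a,
        (@fhom _ _ phi X Y f : lieHom _ _) (tau X a) = tau Y (f a)].
Proof.
move=> inf ff fu es; have [x [y [_ [xy _ _]]]] := three_letters inf.
have [c cE] := image_elt_bracket inf ff fu es x.
have c0 : c != 0.
  apply/eqP => c0; apply: (free_nonabelian (P := P) xy).
  by apply: (@image_elt_inj _ _ _ ff fu x); rewrite cE c0 scale0r image_elt0.
have [s sE] := field_bijection_aut (sigmaD inf ff fu es x)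
  (@sigmaM _ _ _ ff fu x) (sigma1 ff fu x) (@sigma_inj _ _ _ ff fu x)
  (@sigma_surj _ _ _ ff fu x).
exists s, (fun X a => c *: image_elt ff fu x a); split.
- move=> X; split=> [a u v|u v].
    rewrite (image_eltD inf ff fu es) image_elt_scale sE scalerDr !scalerA.
    by rewrite [c * _]mulrC.
  by rewrite cE bracketZl bracketZr.
- move=> X u v /(congr1 (fun t => c^-1 *: t)).
  by rewrite !scalerA mulVf // !scale1r => /(image_elt_inj).
- move=> X u; have [a aE] := image_elt_surj ff fu x (c^-1 *: u).
  by exists a; rewrite aE scalerA mulfV // scale1r.
- move=> X Y f a; rewrite lieHomZ; congr (_ *: _).
  exact: image_elt_nat.
Qed.

(** * Equivalences of categories, closed congruences and twists *)

Section Equivalence.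
Variables (C D : category) (F : functor C D) (G : functor D C).

Lemma nat_iso_eq (F' : functor C D) : F = F' -> nat_iso F F'.
Proof.
move=> <-; exists (fun a => idm (F a)), (fun a => idm (F a)).
by split=> [a|a|a b f]; rewrite ?cmp1f ?cmpf1.
Qed.

Lemma nat_iso_id_faithful (G' : functor D C) :
  nat_iso (comp_functor G' F) (id_functor C) -> faithful F.
Proof.
move=> [u [v [vu uv nat]]] a b f g fg.
have h (k : hom a b) : k = cmp (cmp (u b) (fhom G' (fhom F k))) (v a).
  have := nat _ _ k => /= ->; rewrite -cmpA.
  by have := uv a => /= ->; rewrite cmpf1.
by rewrite (h f) (h g) fg.
Qed.

End Equivalence.

Section EquivalenceProps.
Variables (C D : category) (F : functor C D) (G : functor D C).
Hypothesis FG : is_equivalence F G.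

Lemma equivalence_faithful : faithful F.
Proof. exact: nat_iso_id_faithful FG.1. Qed.

Lemma equivalence_full : full F.
Proof.
move=> a b h; have [u [v [vu uv nat]]] := FG.1.
exists (cmp (cmp (u b) (fhom G h)) (v a)).
apply: (nat_iso_id_faithful FG.2).
have vm (c : C) (k l : hom c (G (F b))) : cmp (u b) k = cmp (u b) l -> k = l.
  move=> /(congr1 (cmp (v b))); rewrite !cmpA.
  by have := vu b => /= ->; rewrite !cmp1f.
apply: vm; have := nat _ _ (cmp (cmp (u b) (fhom G h)) (v a)) => /= ->.
rewrite -!cmpA; have := vu a => /= ->; by rewrite cmpf1.
Qed.

Lemma equivalence_ess_surj : ess_surj F.
Proof.
move=> d; have [u [v [vu uv _]]] := FG.2.
exists (G d), (u d), (v d); split; [exact: (vu d)|exact: (uv d)].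
Qed.

End EquivalenceProps.

Lemma iso_equivalence (C D : category) (F : functor C D) (G : functor D C) :
  comp_functor G F = id_functor C -> comp_functor F G = id_functor D ->
  is_equivalence F G.
Proof. by move=> GF FG; split; exact: nat_iso_eq. Qed.

Section Closed.
Variables (P : fieldType).

Lemma closed_congE (W H : lieAlgType P) (S : set (W * W)) :
  closed_cong H S <-> kernel (solutions H S) = S.
Proof.
by split=> [|<-]; [exact: kernel_solutions|exists (solutions H S)].
Qed.

Lemma kernel_solutions_closed (W H : lieAlgType P) (S : set (W * W)) :
  closed_cong H (kernel (solutions H S)).
Proof. by exists (solutions H S). Qed.

Lemma sub_kernel_solutions (W H : lieAlgType P) (S : set (W * W)) :
  S `<=` kernel (solutions H S).
Proof. by move=> p Sp mu; apply. Qed.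

Lemma kernel_solutions_min (W H : lieAlgType P) (S T : set (W * W)) :
  closed_cong H T -> S `<=` T -> kernel (solutions H S) `<=` T.
Proof.
move=> /closed_congE <- ST p pS mu muT; apply: pS => q Sq.
by have := ST q Sq; apply.
Qed.

Lemma closed_preimage (W W' H : lieAlgType P) (f : lieHom W W')
    (S : set (W' * W')) :
  closed_cong H S -> closed_cong H [set p | S (f p.1, f p.2)].
Proof.
move=> [A ->]; exists [set lie_comp mu f | mu in A]; apply/seteqP; split=> -[a b] /=.
  by move=> h _ [mu Amu <-]; exact: h.
by move=> h mu Amu; apply: (h (lie_comp mu f)); exists mu.
Qed.

(** The closure of T is the least closed congruence containing T. *)
Lemma geom_equiv_closed (X0 : choiceType) (H1 H2 : lieAlgType P) :
  geom_equiv X0 H1 H2 <->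
  forall (X : {fset X0}) (S : set (freeLie P X * freeLie P X)),
    closed_cong H1 S <-> closed_cong H2 S.
Proof.
split=> [h X S|h X T]; first by rewrite !closed_congE h.
apply/seteqP; split; apply: kernel_solutions_min; try exact: sub_kernel_solutions.
  by apply/h; exact: kernel_solutions_closed.
by apply/h; exact: kernel_solutions_closed.
Qed.

End Closed.

Section TwistHom.
Variables (P : fieldType) (s : fieldAut P) (A B H : lieAlgType P).

Section Pull.
Variables (f : A -> B) (hf : lie_semilinear s f) (mu : lieHom B (twist s H)).

Definition twist_pull_fun (x : A) : H := mu (f x).

Lemma twist_pull_linear a x y :
  twist_pull_fun (a *: x + y) = a *: twist_pull_fun x + twist_pull_fun y.
Proof.
rewrite /twist_pull_fun (semi_linear hf) lie_linear.
by rewrite -[X in X + _]/(aut_inv s (s a) *: (mu (f x) : H)) aut_funK.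
Qed.

Lemma twist_pull_bracket x y :
  twist_pull_fun (bracket x y) = bracket (twist_pull_fun x) (twist_pull_fun y).
Proof. by rewrite /twist_pull_fun (semi_bracket hf) lie_bracket. Qed.

Definition twist_pull : lieHom A H := LieHom twist_pull_linear twist_pull_bracket.
End Pull.

Section Push.
Variables (g : B -> A) (hg : lie_semilinear (aut_V s) g) (nu : lieHom A H).

Definition twist_push_fun (y : B) : twist s H := nu (g y).

Lemma twist_push_linear a x y :
  twist_push_fun (a *: x + y) = a *: twist_push_fun x + twist_push_fun y.
Proof. by rewrite /twist_push_fun (semi_linear hg) lie_linear. Qed.

Lemma twist_push_bracket x y :
  twist_push_fun (bracket x y) = bracket (twist_push_fun x) (twist_push_fun y).
Proof. by rewrite /twist_push_fun (semi_bracket hg) lie_bracket. Qed.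

Definition twist_push : lieHom B (twist s H) :=
  LieHom twist_push_linear twist_push_bracket.
End Push.

Lemma semilinear_inv (f : A -> B) (g : B -> A) :
  lie_semilinear s f -> cancel f g -> cancel g f -> lie_semilinear (aut_V s) g.
Proof.
move=> hf fg gf; split=> [a x y|x y]; apply: (can_inj fg).
  by rewrite (semi_linear hf) !gf aut_invK.
by rewrite (semi_bracket hf) !gf.
Qed.

(** Homomorphisms to a twist of H are semilinear maps to H; composing with a
    semilinear bijection turns them into homomorphisms to H. *)
Lemma closed_twist (f : A -> B) (g : B -> A) (S : set (B * B)) :
  lie_semilinear s f -> cancel f g -> cancel g f ->
  closed_cong (twist s H) S <-> closed_cong H [set p | S (f p.1, f p.2)].
Proof.
move=> hf fg gf; have hg := semilinear_inv hf fg gf.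
split=> -[K SE].
  rewrite SE; exists [set twist_pull hf mu | mu in K].
  apply/seteqP; split=> -[a b] /=.
    by move=> h _ [mu Kmu <-]; exact: h.
  by move=> h mu Kmu; apply: (h (twist_pull hf mu)); exists mu.
have SE' p : S p <-> kernel K (g p.1, g p.2).
  by rewrite -SE /= !gf; case: p.
exists [set twist_push hg nu | nu in K]; apply/seteqP; split=> -[a b] /=.
  by move=> /SE' h _ [nu Knu <-]; exact: h.
by move=> h; apply/SE' => nu Knu; apply: (h (twist_push hg nu)); exists nu.
Qed.

End TwistHom.

(** * From equivalences of algebraic sets to twisted geometrical equivalence *)

Section Represent.
Variables (P : fieldType) (X0 : choiceType) (H : lieAlgType P).
Local Notation W X := (freeLie P (fset_sub_type X)).

Definition K0_of (X Y : {fset X0}) (s : lieHom (W Y) (W X)) : K0hom H X Y :=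
  exist _ (fun nu => lie_comp nu s) (ex_intro _ s (fun nu => erefl)).

Lemma K0_of_surj (X Y : {fset X0}) (f : K0hom H X Y) : exists s, K0_of s = f.
Proof. by have [s sE] := svalP f; exists s; apply: K0homP => nu; rewrite sE. Qed.

Lemma K0_of_comp (X Y Z : {fset X0}) (s : lieHom (W Y) (W X)) (t : lieHom (W Z) (W Y)) :
  K0_of (lie_comp s t) = K0comp (K0_of t) (K0_of s).
Proof. by apply: K0homP => nu /=; rewrite lie_compA. Qed.

Lemma K0_of_id (X : {fset X0}) : K0_of (lie_id (W X)) = K0id H X.
Proof. by apply: K0homP => nu /=; rewrite lie_compf1. Qed.

(** Pairs that no homomorphism to H separates are equal, as H generates the
    variety. *)
Lemma K0_of_inj (VarH : forall L : lieAlgType P, Var H L) (X Y : {fset X0}) :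
  injective (@K0_of X Y).
Proof.
move=> s t st; apply: lieHomP => w.
have [A AE] := trivial_closed VarH X.
suff : [set p : W X * W X | p.1 = p.2] (s w, t w) by [].
rewrite AE => nu _; have /(congr1 (fun f => sval f nu)) := st.
by move=> /(congr1 (fun h : lieHom _ _ => h w)).
Qed.

(** A closed congruence given by a morphism from O to the object of X. All closed
    congruences arise, already with r the identity ([closed_agree]), and
    [K_of_comp] expresses membership by composition in the category. *)
Definition agree (O : Kob X0 H) (X : {fset X0}) (r : lieHom (W X) (W (kvars O))) :
    set (W X * W X) :=
  [set p | forall nu, kset O nu -> nu (r p.1) = nu (r p.2)].

Lemma agree_closed O X (r : lieHom (W X) (W (kvars O))) : closed_cong H (agree r).
Proof.
exact: (closed_preimage r (closed_kernel (kset O))).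
Qed.

Lemma closed_agree (X : {fset X0}) (S : set (W X * W X)) : closed_cong H S ->
  S = agree (O := KOb (algebraic_solutions H S)) (lie_id (W X)).
Proof.
by move=> /closed_congE {1}<-; apply/seteqP; split=> -[a b].
Qed.

Definition K_of (O : Kob X0 H) (X : {fset X0}) (r : lieHom (W X) (W (kvars O))) :
  Khom O (K0_in_K_ob H X).
Proof.
exists (fun nu => exist _ (lie_comp (sval nu) r) I).
by exists r.
Defined.

Lemma K_of_surj (O : Kob X0 H) (X : {fset X0}) (f : Khom O (K0_in_K_ob H X)) :
  exists r, K_of r = f.
Proof. by have [r rE] := svalP f; exists r; apply: KhomP => nu; rewrite rE. Qed.

Lemma K_of_comp (O : Kob X0 H) (X Y : {fset X0}) (r : lieHom (W X) (W (kvars O)))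
    (s t : lieHom (W Y) (W X)) :
  @cmp (K X0 H) _ _ _ (@fhom _ _ (K0_in_K X0 H) X Y (K0_of s)) (K_of r)
  = @cmp (K X0 H) _ _ _ (@fhom _ _ (K0_in_K X0 H) X Y (K0_of t)) (K_of r)
  <-> forall w, agree r (s w, t w).
Proof.
split=> [h w nu Onu|h].
  have /(congr1 (fun f : lieHom _ _ => f w)) := congr1 (fun f : Khom _ _ =>
    sval (sval f (exist _ nu Onu))) h.
  by [].
apply: KhomP => -[nu Onu] /=; apply: lieHomP => w; exact: h.
Qed.

End Represent.
Arguments K0_of {P X0} H {X Y} s.

Section Transfer.
Variables (P : fieldType) (X0 : choiceType).
Hypothesis X0_infinite : infinite_set [set: X0].
Variables (H1 H2 : lieAlgType P).
Hypotheses (VarH1 : forall L : lieAlgType P, Var H1 L)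
  (VarH2 : forall L : lieAlgType P, Var H2 L).
Variables (F : functor (K X0 H1) (K X0 H2)) (G : functor (K X0 H2) (K X0 H1)).
Hypothesis FG : is_equivalence F G.
Variables (F0 : functor (K0 X0 H1) (K0 X0 H2)) (G0 : functor (K0 X0 H2) (K0 X0 H1)).
Hypothesis FG0 : is_equivalence F0 G0.
Hypothesis F_F0 : induces (K0_in_K X0 H1) (K0_in_K X0 H2) F F0.
Local Notation W X := (freeLie P (fset_sub_type X)).

Definition phi_ob (X : {fset X0}) : {fset X0} := F0 X.

Definition phi_rep (X Y : {fset X0}) (s : lieHom (W X) (W Y)) :
    lieHom (W (phi_ob X)) (W (phi_ob Y)) :=
  projT1 (cid (K0_of_surj (@fhom _ _ F0 Y X (K0_of H1 s)))).

Lemma phi_repE (X Y : {fset X0}) (s : lieHom (W X) (W Y)) :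
  K0_of H2 (phi_rep s) = @fhom _ _ F0 Y X (K0_of H1 s).
Proof. exact: (projT2 (cid (K0_of_surj (@fhom _ _ F0 Y X (K0_of H1 s))))). Qed.

Lemma phi_rep1 X : phi_rep (lie_id (W X)) = lie_id _.
Proof.
apply: (K0_of_inj VarH2); rewrite phi_repE !K0_of_id.
exact: (fhom1 F0).
Qed.

Lemma phi_repM X Y Z (t : lieHom (W Y) (W Z)) (s : lieHom (W X) (W Y)) :
  phi_rep (lie_comp t s) = lie_comp (phi_rep t) (phi_rep s).
Proof.
apply: (K0_of_inj VarH2); rewrite phi_repE !K0_of_comp !phi_repE.
exact: (@fhomM _ _ F0 Z Y X).
Qed.

Definition phi : functor (Theta0 P X0) (Theta0 P X0) :=
  @Functor (Theta0 P X0) (Theta0 P X0) phi_ob (fun X Y s => phi_rep s)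
    phi_rep1 (fun X Y Z t s => phi_repM t s).

Lemma phi_faithful : faithful phi.
Proof.
move=> X Y s t /(congr1 (K0_of H2)); rewrite !phi_repE.
by move=> /(equivalence_faithful FG0) /(K0_of_inj VarH1).
Qed.

Lemma phi_full : full phi.
Proof.
move=> X Y h; have [g gE] := equivalence_full FG0
  (K0_of H2 h : @hom (K0 X0 H2) (F0 Y) (F0 X)).
have [s sE] := K0_of_surj g; exists s.
by apply: (K0_of_inj VarH2); rewrite phi_repE sE.
Qed.

Lemma phi_ess_surj : ess_surj phi.
Proof.
move=> Z; have [X [u [v [vu uv]]]] := equivalence_ess_surj FG0 (Z : K0 X0 H2).
have [s sE] := K0_of_surj u; have [t tE] := K0_of_surj v.
exists X, t, s; split; apply: (K0_of_inj VarH2); rewrite K0_of_comp K0_of_id sE tE.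
  exact: vu.
exact: uv.
Qed.

Section Points.
Variables (s : fieldAut P) (tau : forall X : {fset X0}, W X -> W (phi X)).
Hypotheses (tau_semi : forall X, lie_semilinear s (@tau X))
  (tau_nat : forall (X Y : {fset X0}) (f : lieHom (W X) (W Y)) a,
    phi_rep f (tau a) = tau (f a))
  (tau_surj : forall (X : {fset X0}) u, exists a : W X, tau a = u).
Variable x0 : X0.

Lemma agree_point (H : lieAlgType P) (O : Kob X0 H) (X : {fset X0})
    (r : lieHom (W X) (W (kvars O))) a b :
  agree r (a, b) <-> forall w, agree r (point x0 a w, point x0 b w).
Proof.
split=> [ab w nu Onu|/(_ (gen P (base x0)))]; last by rewrite !pointE.
have [l ->] := free_rank1 w (@base_uniq _ x0).
by rewrite !lieHomZ !pointE; congr (_ *: _); exact: ab.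
Qed.

Lemma agree_point_image (H : lieAlgType P) (O : Kob X0 H) (X : {fset X0})
    (r : lieHom (W (phi X)) (W (kvars O))) a b :
  agree r (tau a, tau b)
  <-> forall w, agree r (phi_rep (point x0 a) w, phi_rep (point x0 b) w).
Proof.
split=> [ab w nu Onu|/(_ (tau (gen P (base x0))))]; last first.
  by rewrite !tau_nat !pointE.
have [u <-] := tau_surj w; have [l ->] := free_rank1 u (@base_uniq _ x0).
rewrite /= !tau_nat !lieHomZ !pointE !(semiZ (tau_semi _)) !lieHomZ; congr (_ *: _).
exact: ab.
Qed.

Local Notation J1 := (K0_in_K X0 H1).
Local Notation J2 := (K0_in_K X0 H2).

(** Both sides say that two composites with the objects of rank one are equal, the
    second pair being the image of the first by F up to the isomorphisms u and bet. *)
Lemma agree_transfer (u : forall X, @hom (K X0 H2) (F (J1 X)) (J2 (F0 X)))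
    (v : forall X, @hom (K X0 H2) (J2 (F0 X)) (F (J1 X)))
    (vu : forall X, cmp (v X) (u X) = idm _)
    (nat : forall X Y (f : @hom (K0 X0 H1) X Y),
      cmp (u Y) (fhom F (fhom J1 f)) = cmp (fhom J2 (fhom F0 f)) (u X))
    (O : K X0 H1) (O' : K X0 H2) (bet : hom (F O) O') (gam : hom O' (F O))
    (bg : cmp bet gam = idm O')
    (X : {fset X0}) (r : lieHom (W X) (W (kvars O)))
    (r' : lieHom (W (phi X)) (W (kvars O'))) :
  cmp (u X) (fhom F (K_of r : @hom (K X0 H1) O (J1 X)))
  = cmp (K_of r' : @hom (K X0 H2) O' (J2 (F0 X))) bet ->
  forall a b, agree r (a, b) <-> agree r' (tau a, tau b).
Proof.
move=> urE a b; rewrite agree_point agree_point_image -!K_of_comp !phi_repE.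
have key c : cmp (u _) (fhom F (cmp
    (fhom J1 (K0_of H1 (point x0 c) : @hom (K0 X0 H1) X _))
    (K_of r : @hom (K X0 H1) O (J1 X))))
  = cmp (cmp (fhom J2 (fhom F0 (K0_of H1 (point x0 c) : @hom (K0 X0 H1) X _)))
      (K_of r' : @hom (K X0 H2) O' (J2 (F0 X)))) bet.
  by rewrite fhomM cmpA nat -cmpA urE cmpA.
split=> h.
  have := key a; rewrite h key => /(congr1 (fun f => cmp f gam)).
  by rewrite -!cmpA bg !cmpf1.
apply: (equivalence_faithful FG).
have := key a; rewrite h -key => /(congr1 (cmp (v _))).
by rewrite !cmpA vu !cmp1f.
Qed.

(** From left to right the morphism defining S is sent by F; from right to left the
    morphism defining S' is lifted along F, which is full and essentially surjective. *)
Lemma closed_transfer (X : {fset X0}) (S : set (W X * W X))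
    (S' : set (W (phi X) * W (phi X))) :
  (forall a b, S (a, b) <-> S' (tau a, tau b)) ->
  closed_cong H1 S <-> closed_cong H2 S'.
Proof.
move=> SS'; have [u [v [vu uv nat]]] := nat_iso_eq F_F0.
have ext (T : set (W (phi X) * W (phi X))) :
    (forall a b, S (a, b) <-> T (tau a, tau b)) -> S' = T.
  move=> ST; apply/seteqP; split=> -[c d];
    have [a <-] := tau_surj c; have [b <-] := tau_surj d.
    by move=> /SS' /ST.
  by move=> /ST /SS'.
split=> [/closed_agree SE|/closed_agree SE].
  set O := KOb _ in SE; set r := lie_id _ in SE.
  have [r' rE] := K_of_surj (cmp (u X)
    (fhom F (@K_of _ _ _ O X r : @hom (K X0 H1) O (J1 X)))).
  rewrite (ext (agree r')); first exact: agree_closed.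
  move=> a b; rewrite SE.
  apply: (agree_transfer vu nat (O' := F O) (bet := idm _) (gam := idm _)).
    by rewrite cmp1f.
  by rewrite cmpf1 rE.
set O' := KOb _ in SE; set r' := lie_id _ in SE.
have [O [bet [gam [gb bg]]]] := equivalence_ess_surj FG (O' : K X0 H2).
have [g gE] := equivalence_full FG
  (cmp (v X) (cmp (@K_of _ _ _ O' _ r' : @hom (K X0 H2) O' (J2 (F0 X))) bet)).
have [r rE] := K_of_surj g.
suff -> : S = agree r by exact: agree_closed.
have SS'' a b : S (a, b) <-> agree r (a, b).
  rewrite SS' SE; apply: iff_sym.
  apply: (agree_transfer vu nat bg); rewrite rE gE.
  by rewrite -[RHS]cmp1f -(uv X) -cmpA.
by apply/seteqP; split=> -[a b] /SS''.
Qed.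

End Points.

Theorem equivalence_twisted_geom_equiv : twisted_geom_equiv X0 H1 H2.
Proof.
have [s [tau [tau_semi tau_inj tau_surj tau_nat]]] :=
  autoequivalence_semi_inner X0_infinite phi_faithful phi_full phi_ess_surj.
have [x0 [_ [_ _]]] := three_letters X0_infinite.
exists s; apply/geom_equiv_closed => Z S.
have [X [al [be [beal albe]]]] := phi_ess_surj Z.
have beK z : (be : lieHom _ _) ((al : lieHom _ _) z) = z.
  exact: (congr1 (fun h : lieHom _ _ => h z) beal).
have alK z : (al : lieHom _ _) ((be : lieHom _ _) z) = z.
  exact: (congr1 (fun h : lieHom _ _ => h z) albe).
have /choice [tinv tauK'] : forall u, exists a, tau X a = u by exact: tau_surj.
have tauK : cancel (tau X) tinv by move=> a; apply: tau_inj; rewrite tauK'.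
pose f : W X -> W Z := (al : lieHom _ _) \o tau X.
pose g : W Z -> W X := tinv \o (be : lieHom _ _).
have fg : cancel f g by move=> a; rewrite /f /g /= beK tauK.
have gf : cancel g f by move=> a; rewrite /f /g /= tauK' alK.
rewrite (closed_twist H1 S (semi_comp (tau_semi X) al) fg gf).
pose S' : set (W (phi X) * W (phi X)) :=
  [set p | S ((al : lieHom _ _) p.1, (al : lieHom _ _) p.2)].
rewrite (@closed_transfer s tau tau_semi tau_nat tau_surj x0 X _ S') //.
split=> [h|]; last exact: closed_preimage.
suff -> : S = [set p | S' ((be : lieHom _ _) p.1, (be : lieHom _ _) p.2)].
  exact: closed_preimage.
by rewrite /S'; apply/seteqP; split=> -[a b] /=; rewrite !alK.
Qed.

End Transfer.

(** * From twisted geometrical equivalence to isomorphisms of categories *)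

Section FunctorEq.
Variables (C D : category).

(** Equal objects are related by a canonical morphism. Functors are compared up to these
    morphisms, which avoids transporting morphisms along equalities of objects. *)
Definition eq_mor (a b : C) (e : a = b) : hom a b :=
  match e in _ = c return hom a c with erefl => idm a end.

Lemma eq_mor_id (a : C) (e : a = a) : eq_mor e = idm a.
Proof. by rewrite (Prop_irrelevance e erefl). Qed.

End FunctorEq.

Lemma functor_eq (C D : category) (F G : functor C D) (e : forall a, F a = G a) :
  (forall a b (f : hom a b),
     cmp (eq_mor (e b)) (fhom F f) = cmp (fhom G f) (eq_mor (e a))) -> F = G.
Proof.
case: F G e => [Fo Fh F1 FM] [Go Gh G1 GM] /= e h.
have E : Fo = Go by exact/funext.
subst Go; have {}h : Fh = Gh.
  apply/functional_extensionality_dep => a.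
  apply/functional_extensionality_dep => b.
  apply/functional_extensionality_dep => f.
  by have := h a b f; rewrite !eq_mor_id cmp1f cmpf1.
by subst Gh; congr Functor; exact: Prop_irrelevance.
Qed.

Section CastObjects.
Variables (P : fieldType) (X0 : choiceType) (H : lieAlgType P) (X : {fset X0}).
Local Notation W X := (freeLie P (fset_sub_type X)).

Lemma Kob_eq (A B : set (lieHom (W X) H)) (hA : algebraic A) (hB : algebraic B) :
  A = B -> KOb hA = KOb hB.
Proof. by move=> AB; subst B; rewrite (Prop_irrelevance hA hB). Qed.

Lemma eq_mor_K (A B : set (lieHom (W X) H)) (hA : algebraic A) (hB : algebraic B)
    (e : KOb hA = KOb hB :> K X0 H) (AB : A = B) nu :
  sval (sval (eq_mor e : Khom (KOb hA) (KOb hB)) nu) = sval nu.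
Proof.
by subst B; move: e; rewrite (Prop_irrelevance hB hA) => e; rewrite eq_mor_id.
Qed.

Lemma Cob_eq (S T : set (W X * W X)) (hS : closed_cong H S) (hT : closed_cong H T) :
  S = T -> COb hS = COb hT.
Proof. by move=> ST; subst T; rewrite (Prop_irrelevance hS hT). Qed.

Lemma eq_mor_C (S T : set (W X * W X)) (hS : closed_cong H S) (hT : closed_cong H T)
    (e : COb hS = COb hT :> C X0 H) (ST : S = T) :
  lie_comp (eq_mor e : lieHom (Calg (COb hS)) (Calg (COb hT))) (Cpi (COb hS))
  = Cpi (COb hT).
Proof.
subst T; move: e; rewrite (Prop_irrelevance hT hS) => e.
by rewrite eq_mor_id lie_comp1f.
Qed.

End CastObjects.

Section Coefficients.
Variable P : fieldType.

(** A homomorphism to the twist by the inverse of s is an s-semilinear map. *)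
Definition coef_map (s : fieldAut P) (V : Type) (u : freeLie P V) : freeLie P V :=
  @free_ext P V (twist (aut_V s) (freeLie P V)) (@gen P V) u.

Arguments coef_map s {V} u.

Lemma coef_map_semi s V : lie_semilinear s (@coef_map s V).
Proof. by split=> [a x y|x y]; rewrite /coef_map ?lie_linear ?lie_bracket. Qed.

Lemma coef_map_gen s V (x : V) : coef_map s (gen P x) = gen P x.
Proof. exact: (@free_ext_gen P V (twist (aut_V s) (freeLie P V))). Qed.

Lemma coef_mapK (s t : fieldAut P) V :
  cancel s t -> cancel (@coef_map s V) (coef_map t).
Proof.
move=> st.
have lin (a : P) (x y : freeLie P V) :
    coef_map t (coef_map s (a *: x + y))
    = a *: coef_map t (coef_map s x) + coef_map t (coef_map s y).
  by rewrite !(semi_linear (coef_map_semi _ _)) st.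
have br (x y : freeLie P V) : coef_map t (coef_map s (bracket x y))
    = bracket (coef_map t (coef_map s x)) (coef_map t (coef_map s y)).
  by rewrite !(semi_bracket (coef_map_semi _ _)).
have h : LieHom lin br = lie_id _.
  by apply: free_hom_ext => x /=; rewrite !coef_map_gen.
by move=> u; have := congr1 (fun f : lieHom _ _ => f u) h.
Qed.

End Coefficients.
Arguments coef_map {P} s {V} u.

Section Conjugation.
Variables (P : fieldType) (X0 : choiceType) (s t : fieldAut P).
Local Notation W X := (freeLie P (fset_sub_type X)).
Hypotheses (st : cancel s t) (ts : cancel t s).

Let stK V : cancel (@coef_map P s V) (coef_map t) := coef_mapK st.
Let tsK V : cancel (@coef_map P t V) (coef_map s) := coef_mapK ts.

Section Cj.
Variables (X Y : {fset X0}) (f : lieHom (W X) (W Y)).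

Definition conj_hom_fun (u : W X) : W Y := coef_map s (f (coef_map t u)).

Lemma conj_hom_linear a x y :
  conj_hom_fun (a *: x + y) = a *: conj_hom_fun x + conj_hom_fun y.
Proof.
rewrite /conj_hom_fun (semi_linear (coef_map_semi t _)) lie_linear.
by rewrite (semi_linear (coef_map_semi s _)) ts.
Qed.

Lemma conj_hom_bracket x y :
  conj_hom_fun (bracket x y) = bracket (conj_hom_fun x) (conj_hom_fun y).
Proof.
rewrite /conj_hom_fun (semi_bracket (coef_map_semi t _)) lie_bracket.
by rewrite (semi_bracket (coef_map_semi s _)).
Qed.

Definition conj_hom : lieHom (W X) (W Y) := LieHom conj_hom_linear conj_hom_bracket.

End Cj.

Lemma conj_homE X Y (f : lieHom (W X) (W Y)) u :
  conj_hom f u = coef_map s (f (coef_map t u)).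
Proof. by []. Qed.

Lemma conj_hom1 X : conj_hom (lie_id (W X)) = lie_id (W X).
Proof. by apply: lieHomP => u; rewrite conj_homE tsK. Qed.

Lemma conj_homM X Y Z (g : lieHom (W Y) (W Z)) (f : lieHom (W X) (W Y)) :
  conj_hom (lie_comp g f) = lie_comp (conj_hom g) (conj_hom f).
Proof. by apply: lieHomP => u; rewrite lie_compE !conj_homE lie_compE stK. Qed.

Definition Theta_conj : functor (Theta0 P X0) (Theta0 P X0) :=
  @Functor (Theta0 P X0) (Theta0 P X0) id (fun X Y f => conj_hom f) conj_hom1
    (fun X Y Z g f => conj_homM g f).

(** The image of S under the action of s on coefficients, written as a preimage
    under its inverse t. *)
Definition coef_image (X : {fset X0}) (S : set (W X * W X)) : set (W X * W X) :=
  [set p | S (coef_map t p.1, coef_map t p.2)].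

Variables (H1 H2 : lieAlgType P).
Hypothesis VarH1 : forall L : lieAlgType P, Var H1 L.

Section K0conj.

Definition K0conj_hom (X Y : {fset X0}) (f : K0hom H1 X Y) : K0hom H2 X Y :=
  K0_of H2 (conj_hom (projT1 (cid (K0_of_surj f)))).

Lemma K0conj_homE X Y (f : lieHom (W Y) (W X)) :
  K0conj_hom (K0_of H1 f) = K0_of H2 (conj_hom f).
Proof.
rewrite /K0conj_hom; case: cid => g /= gE.
by rewrite (K0_of_inj VarH1 gE).
Qed.

Lemma K0conj1 (X : {fset X0}) : K0conj_hom (K0id H1 X) = K0id H2 X.
Proof. by rewrite -K0_of_id K0conj_homE conj_hom1 K0_of_id. Qed.

Lemma K0conjM (X Y Z : {fset X0}) (g : K0hom H1 Y Z) (f : K0hom H1 X Y) :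
  K0conj_hom (K0comp g f) = K0comp (K0conj_hom g) (K0conj_hom f).
Proof.
have [a <-] := K0_of_surj f; have [b <-] := K0_of_surj g.
by rewrite -K0_of_comp !K0conj_homE conj_homM K0_of_comp.
Qed.

Definition K0conj : functor (K0 X0 H1) (K0 X0 H2) :=
  @Functor (K0 X0 H1) (K0 X0 H2) id K0conj_hom K0conj1 K0conjM.

End K0conj.

Hypothesis closed12 : forall (X : {fset X0}) (S : set (W X * W X)),
  closed_cong H1 S -> closed_cong H2 (coef_image S).

Lemma kernel_solutions_coef_image (O : Kob X0 H1) :
  kernel (solutions H2 (coef_image (kernel (kset O)))) = coef_image (kernel (kset O)).
Proof. by apply: kernel_solutions; apply: closed12; exact: closed_kernel. Qed.

Definition Kconj_ob (O : Kob X0 H1) : Kob X0 H2 :=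
  KOb (algebraic_solutions H2 (coef_image (kernel (kset O)))).

Section Hom.
Variables (O1 O2 : Kob X0 H1) (f : Khom O1 O2).
Variable (r : lieHom (W (kvars O2)) (W (kvars O1))).
Hypothesis rE : forall nu, sval (sval f nu) = lie_comp (sval nu) r.

Lemma rep_kernel p : kernel (kset O2) p -> kernel (kset O1) (r p.1, r p.2).
Proof.
move=> pO nu Onu; have := pO _ (svalP (sval f (exist _ nu Onu))).
by rewrite /Ker /= rE.
Qed.

Lemma Kconj_val (nu : {nu | kset (Kconj_ob O1) nu}) :
  kset (Kconj_ob O2) (lie_comp (sval nu) (conj_hom r)).
Proof.
case: nu => nu Onu /= -[a b] ab; apply: (Onu (conj_hom r a, conj_hom r b)).
rewrite /coef_image /= !stK.
exact: (rep_kernel ab).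
Qed.

End Hom.

(** The conjugate of a representative of f determines the same morphism for all
    representatives: they agree modulo the kernel, which the action of s preserves. *)
Lemma Kconj_rep_uniq (O1 O2 : Kob X0 H1) (f : Khom O1 O2)
    (r r' : lieHom (W (kvars O2)) (W (kvars O1))) nu :
  (forall nu, sval (sval f nu) = lie_comp (sval nu) r) ->
  (forall nu, sval (sval f nu) = lie_comp (sval nu) r') ->
  kset (Kconj_ob O1) nu -> lie_comp nu (conj_hom r) = lie_comp nu (conj_hom r').
Proof.
move=> rE rE' Onu; apply: lieHomP => w; apply: (Onu (conj_hom r w, conj_hom r' w)).
rewrite /coef_image /= !stK => mu Omu.
have := rE' (exist _ mu Omu); rewrite rE.
exact: (congr1 (fun h : lieHom _ _ => h (coef_map t w))).
Qed.

Definition Kconj_fun (O1 O2 : Kob X0 H1) (f : Khom O1 O2)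
    (nu : {nu | kset (Kconj_ob O1) nu}) : {nu | kset (Kconj_ob O2) nu} :=
  exist _ _ (Kconj_val (projT2 (cid (svalP f))) nu).

Lemma Kconj_subproof (O1 O2 : Kob X0 H1) (f : Khom O1 O2) :
  exists r : lieHom (W (kvars (Kconj_ob O2))) (W (kvars (Kconj_ob O1))),
    forall nu, sval (Kconj_fun f nu) = lie_comp (sval nu) r.
Proof. by exists (conj_hom (projT1 (cid (svalP f)))). Qed.

Definition Kconj_hom (O1 O2 : Kob X0 H1) (f : Khom O1 O2) :
    Khom (Kconj_ob O1) (Kconj_ob O2) := exist _ (Kconj_fun f) (Kconj_subproof f).

Lemma Kconj_homE (O1 O2 : Kob X0 H1) (f : Khom O1 O2)
    (r : lieHom (W (kvars O2)) (W (kvars O1))) nu :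
  (forall nu, sval (sval f nu) = lie_comp (sval nu) r) ->
  sval (sval (Kconj_hom f) nu) = lie_comp (sval nu) (conj_hom r).
Proof.
by move=> rE; apply: (Kconj_rep_uniq (f := f)) => //; [case: cid|exact: svalP].
Qed.

Lemma Kconj1 (O : Kob X0 H1) : Kconj_hom (Kid O) = Kid (Kconj_ob O).
Proof.
apply: KhomP => nu; rewrite (@Kconj_homE _ _ _ (lie_id _)) ?conj_hom1 ?lie_compf1 //.
by move=> mu; rewrite lie_compf1.
Qed.

Lemma KconjM (O1 O2 O3 : Kob X0 H1) (g : Khom O2 O3) (f : Khom O1 O2) :
  Kconj_hom (Kcomp g f) = Kcomp (Kconj_hom g) (Kconj_hom f).
Proof.
have [a aE] := svalP f; have [b bE] := svalP g.
apply: KhomP => nu; rewrite (@Kconj_homE _ _ _ (lie_comp a b)); last first.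
  by move=> mu /=; rewrite bE aE lie_compA.
rewrite -[RHS]/(sval (sval (Kconj_hom g) (sval (Kconj_hom f) nu))).
rewrite (@Kconj_homE _ _ _ b) // (@Kconj_homE _ _ _ a) //.
by rewrite conj_homM lie_compA.
Qed.

Definition Kconj : functor (K X0 H1) (K X0 H2) :=
  @Functor (K X0 H1) (K X0 H2) Kconj_ob Kconj_hom Kconj1 KconjM.

Lemma Kconj_induces_K0 : induces (K0_in_K X0 H1) (K0_in_K X0 H2) Kconj K0conj.
Proof.
have full X : solutions H2 (coef_image (kernel [set: lieHom (W X) H1])) = setT.
  apply/seteqP; split=> // nu _ [a b] /= ab; congr (nu _); apply: (can_inj (@tsK X)).
  have [A AE] := trivial_closed VarH1 X.
  suff : [set p : W X * W X | p.1 = p.2] (coef_map t a, coef_map t b) by [].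
  by rewrite AE => mu _; exact: ab.
have e (X : K0 X0 H1) : comp_functor Kconj (K0_in_K X0 H1) X
  = comp_functor (K0_in_K X0 H2) K0conj X := Kob_eq _ _ (full X).
apply: (functor_eq (e := e)) => X Y f.
have [r <-] := K0_of_surj f; apply: KhomP => nu.
rewrite -[LHS]/(sval (sval (eq_mor (e Y)) (sval (Kconj_hom
  (@fhom _ _ (K0_in_K X0 H1) X Y (K0_of H1 r))) nu))).
rewrite (eq_mor_K (e Y) (full Y)).
rewrite (@Kconj_homE (K0_in_K_ob H1 X) (K0_in_K_ob H1 Y) _ r) //.
rewrite -[RHS]/(sval (K0conj_hom (K0_of H1 r)) (sval (sval (eq_mor (e X)) nu))).
rewrite K0conj_homE /=; congr lie_comp.
exact/esym/(eq_mor_K (e X) (full X)).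
Qed.

Lemma Kconj_inclusion : preserves_inclusion Kconj.
Proof.
move=> _ _ [X A B hA hB AB]; apply: KSub => nu h p pB; apply: h => mu Amu.
by apply: pB; exact: AB.
Qed.

Section Dual.
Hypothesis VarH2 : forall L : lieAlgType P, Var H2 L.

Lemma Kconj_induces_Theta0 :
  induces (Theta0_in_C X0 VarH1) (Theta0_in_C X0 VarH2) (dual_functor Kconj) Theta_conj.
Proof.
have diag (X : {fset X0}) : kernel (solutions H2 (coef_image (kernel
    (solutions H1 [set p : W X * W X | p.1 = p.2])))) = [set p | p.1 = p.2].
  have -> : kernel (solutions H1 [set p : W X * W X | p.1 = p.2]) = [set p | p.1 = p.2].
    exact/closed_congE/trivial_closed.
  have -> : coef_image [set p : W X * W X | p.1 = p.2] = [set p | p.1 = p.2].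
    apply/seteqP; split=> -[a b]; rewrite /coef_image /=; last by move->.
    exact: (can_inj (@tsK X)).
  exact/closed_congE/trivial_closed.
have e (X : Theta0 P X0) : comp_functor (dual_functor Kconj) (Theta0_in_C X0 VarH1) X
  = comp_functor (Theta0_in_C X0 VarH2) Theta_conj X := Cob_eq _ _ (diag X).
apply: (functor_eq (e := e)) => X Y f.
pose O Z : Kob X0 H1 := C_to_K_ob (Theta0_in_C_ob VarH1 Z).
apply: quot_hom_ext.
pose g : Khom (O Y) (O X) := C_to_K_hom (Theta0_in_C_hom VarH1 f).
rewrite -[LHS]/(lie_comp (lie_comp (eq_mor (e Y)) (K_to_C_hom (Kconj_hom g)))
   (Cpi (K_to_C_ob (Kconj_ob (O X))))).
rewrite -[LHS]lie_compA.
rewrite (@K_to_C_homE _ _ _ (Kconj_ob (O Y)) (Kconj_ob (O X)) (Kconj_hom g)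
  (conj_hom f)); last first.
  move=> nu; apply: (@Kconj_homE (O Y) (O X)) => mu.
  exact/C_to_K_valE/esym/Theta0_in_C_homE.
rewrite lie_compA (eq_mor_C (e Y) (diag Y)).
rewrite -[RHS]/(lie_comp (lie_comp (Theta0_in_C_hom VarH2 (conj_hom f)) (eq_mor (e X)))
   (Cpi (K_to_C_ob (Kconj_ob (O X))))).
rewrite -[RHS]lie_compA (eq_mor_C (e X) (diag X)).
exact: (esym (@Theta0_in_C_homE P X0 H2 VarH2 X Y (conj_hom f))).
Qed.

End Dual.

End Conjugation.

Section Inverse.
Variables (P : fieldType) (X0 : choiceType) (s t : fieldAut P).
Local Notation W X := (freeLie P (fset_sub_type X)).
Hypotheses (st : cancel s t) (ts : cancel t s).
Variables (H1 H2 : lieAlgType P).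
Hypotheses (VarH1 : forall L : lieAlgType P, Var H1 L)
  (VarH2 : forall L : lieAlgType P, Var H2 L).
Hypotheses (closed12 : forall (X : {fset X0}) (S : set (W X * W X)),
    closed_cong H1 S -> closed_cong H2 (coef_image t S))
  (closed21 : forall (X : {fset X0}) (S : set (W X * W X)),
    closed_cong H2 S -> closed_cong H1 (coef_image s S)).

Lemma conj_homK (X Y : {fset X0}) (f : lieHom (W X) (W Y)) :
  conj_hom st (conj_hom ts f) = f.
Proof. by apply: lieHomP => u; rewrite conj_homE conj_homE !(coef_mapK st). Qed.

Lemma Theta_conjK : comp_functor (Theta_conj X0 ts st) (Theta_conj X0 st ts)
  = id_functor (Theta0 P X0).
Proof.
have e (X : Theta0 P X0) : comp_functor (Theta_conj X0 ts st) (Theta_conj X0 st ts) X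
  = id_functor (Theta0 P X0) X := erefl.
apply: (functor_eq (e := e)) => X Y f; rewrite !eq_mor_id cmp1f cmpf1.
exact: conj_homK.
Qed.

Lemma K0conjK : comp_functor (K0conj X0 ts st H1 VarH2) (K0conj X0 st ts H2 VarH1)
  = id_functor (K0 X0 H1).
Proof.
have e (X : K0 X0 H1) : comp_functor (K0conj X0 ts st H1 VarH2)
  (K0conj X0 st ts H2 VarH1) X = id_functor (K0 X0 H1) X := erefl.
apply: (functor_eq (e := e)) => X Y f; rewrite !eq_mor_id cmp1f cmpf1.
have [r <-] := K0_of_surj f.
rewrite -[LHS]/(K0conj_hom st H1 (K0conj_hom ts H2 (K0_of H1 r))).
by rewrite !K0conj_homE // conj_homK.
Qed.

(** Objects come back to themselves because the image of a closed congruence under the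
    action of s is closed, hence recovered from its solutions. *)
Lemma KconjK : comp_functor (Kconj X0 ts st H2 H1) (Kconj X0 st ts H1 H2)
  = id_functor (K X0 H1).
Proof.
have idO (O : Kob X0 H1) :
    kset (Kconj_ob s H1 (Kconj_ob t H2 O)) = kset O.
  rewrite /= kernel_solutions_coef_image //.
  have -> : coef_image s (coef_image t (kernel (kset O))) = kernel (kset O).
    by apply/seteqP; split=> -[a b]; rewrite /coef_image /= !(coef_mapK st).
  exact/solutions_kernel/kset_algebraic.
have e (O : K X0 H1) : comp_functor (Kconj X0 ts st H2 H1) (Kconj X0 st ts H1 H2) O
    = id_functor (K X0 H1) O.
  by case: O (idO O) => X A hA AE; apply: Kob_eq.
have castE (O : K X0 H1) nu : sval (sval (eq_mor (e O)) nu) = sval nu.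
  by move: (e O) nu; case: O (idO O) => X A hA AE eO nu; apply: eq_mor_K.
apply: (functor_eq (e := e)) => O1 O2 f; apply: KhomP => nu.
have [r rE] := svalP f.
rewrite -[RHS]/(sval (sval f (sval (eq_mor (e O1)) nu))) rE.
rewrite -[LHS]/(sval (sval (eq_mor (e O2)) (sval
  (Kconj_hom ts st H1 (Kconj_hom st ts H2 f)) nu))) !castE.
rewrite (@Kconj_homE _ _ _ _ ts st _ _ (Kconj_ob t H2 O1) (Kconj_ob t H2 O2) _
  (conj_hom ts r)).
  by rewrite conj_homK.
by move=> mu; exact: Kconj_homE.
Qed.

End Inverse.

Section FromTwisted.
Variables (P : fieldType) (X0 : choiceType) (H1 H2 : lieAlgType P).
Hypotheses (VarH1 : forall L : lieAlgType P, Var H1 L)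
  (VarH2 : forall L : lieAlgType P, Var H2 L).
Variable s : fieldAut P.
Hypothesis geomH : geom_equiv X0 (twist s H1) H2.
Local Notation W X := (freeLie P (fset_sub_type X)).
Local Notation t := (aut_V s).

Let st : cancel s t := aut_funK s.
Let ts : cancel t s := aut_invK s.

Lemma closed_twist_coef (X : {fset X0}) (S : set (W X * W X)) :
  closed_cong H2 S <-> closed_cong H1 (coef_image s S).
Proof.
rewrite -(iffLR (geom_equiv_closed X0 (twist s H1) H2) geomH X S).
exact: (closed_twist H1 S (coef_map_semi s _) (coef_mapK st) (coef_mapK ts)).
Qed.

Lemma closed_coef_image (X : {fset X0}) (S : set (W X * W X)) :
  closed_cong H1 S -> closed_cong H2 (coef_image t S).
Proof.
move=> hS; apply/closed_twist_coef; congr (closed_cong H1 _): hS.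
by apply/seteqP; split=> -[a b]; rewrite /coef_image /= !(coef_mapK st).
Qed.

Let closed21 (X : {fset X0}) (S : set (W X * W X)) :
  closed_cong H2 S -> closed_cong H1 (coef_image s S) := iffLR (closed_twist_coef S).

Local Notation F := (Kconj X0 st ts H1 H2).
Local Notation G := (Kconj X0 ts st H2 H1).

Lemma twisted_correctly_isomorphic : correctly_isomorphic X0 VarH1 VarH2.
Proof.
exists F; split.
- exists G; split; [exact: KconjK closed_coef_image|exact: KconjK closed21].
- exists (Theta_conj X0 st ts); split; last exact: Kconj_induces_Theta0.
  by exists (Theta_conj X0 ts st); split; exact: Theta_conjK.
- exists (K0conj X0 st ts H2 VarH1); split; last exact: Kconj_induces_K0.
  by exists (K0conj X0 ts st H1 VarH2); split; exact: K0conjK.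
- exact: Kconj_inclusion.
Qed.

Lemma twisted_correctly_equivalent : correctly_equivalent X0 VarH1 VarH2.
Proof.
exists F, G; split.
- by apply: iso_equivalence; [exact: KconjK closed_coef_image|exact: KconjK closed21].
- exists (Theta_conj X0 st ts), (Theta_conj X0 ts st); split.
  + exact: Kconj_induces_Theta0.
  + exact: Kconj_induces_Theta0.
  + by apply: iso_equivalence; exact: Theta_conjK.
- exists (K0conj X0 st ts H2 VarH1), (K0conj X0 ts st H1 VarH2); split.
  + exact: Kconj_induces_K0.
  + exact: Kconj_induces_K0.
  + by apply: iso_equivalence; exact: K0conjK.
- exact: Kconj_inclusion.
- exact: Kconj_inclusion.
Qed.

End FromTwisted.

(** * Equivalence of the three conditions *)

Theorem theorem5 (P : fieldType) (X0 : choiceType)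
    (X0_infinite : infinite_set [set: X0]) (H1 H2 : lieAlgType P)
    (VarH1 : forall L : lieAlgType P, Var H1 L)
    (VarH2 : forall L : lieAlgType P, Var H2 L) :
  [<-> correctly_isomorphic X0 VarH1 VarH2;
       correctly_equivalent X0 VarH1 VarH2;
       twisted_geom_equiv X0 H1 H2].
Proof.
have iso_twisted : correctly_isomorphic X0 VarH1 VarH2 -> twisted_geom_equiv X0 H1 H2.
  move=> [F [[G [GF FG]] _ [F0 [[G0 [GF0 FG0]] FF0]] _]].
  exact: (equivalence_twisted_geom_equiv X0_infinite VarH1 VarH2
    (iso_equivalence GF FG) (iso_equivalence GF0 FG0) FF0).
tfae=> [/iso_twisted[s hs]|[F [G [FG _ [F0 [G0 [FF0 _ FG0]]] _ _]]]|[s hs]].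
- exact: twisted_correctly_equivalent hs.
- exact: (equivalence_twisted_geom_equiv X0_infinite VarH1 VarH2 FG FG0 FF0).
- exact: twisted_correctly_isomorphic hs.
Qed.
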